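(* (1) For every $\delta>0$ there are constants $c>0$ and $\epsilon>0$, depending only on $\delta$, such that the following holds: for every prime $p$ and every subset $A$ of $\operatorname{SL}_2(\mathbb{Z}/p\mathbb{Z})$ that is not contained in any proper subgroup of $\operatorname{SL}_2(\mathbb{Z}/p\mathbb{Z})$ and satisfies $|A|<p^{3-\delta}$, we have $$|A\cdot A\cdot A|>c\,|A|^{1+\epsilon}.$$ (2) For every $\delta>0$ there is an integer $k>0$, depending only on $\delta$, such that the following holds: for every prime $p$ and every subset $A$ of $\operatorname{SL}_2(\mathbb{Z}/p\mathbb{Z})$ that is not contained in any proper subgroup of $\operatorname{SL}_2(\mathbb{Z}/p\mathbb{Z})$ and satisfies $|A|>p^{\delta}$, every element of $\operatorname{SL}_2(\mathbb{Z}/p\mathbb{Z})$ can be expressed as a product of at most $k$ elements of $A\cup A^{-1}$.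
   Context: $A\cdot A\cdot A=\{xyz: x,y,z\in A\}$, $A^{-1}=\{x^{-1}:x\in A\}$, and $|A|$ is the cardinality of $A$. *)

(* Defs.v *)
From HB Require Import structures.
From mathcomp Require Import all_boot all_order all_algebra all_fingroup.

Set Implicit Arguments.
Unset Strict Implicit.
Unset Printing Implicit Defensive.

Import GRing.Theory.
Local Open Scope group_scope.

(* SL_2(Z/pZ) is realised as a subgroup of GL_2(Z/pZ); its subgroups are the
   H : {group {'GL_2(p)}} with H \subset SL2 p. As usual, 'F_p is Z/pZ only
   for p prime. *)
Definition SL2 (p : nat) : {set {'GL_2(p)}} :=
  [set g : {'GL_2(p)} | (\det (GLval g) == 1)%R].

Lemma SL2_group_set (p : nat) : group_set (SL2 p).
Proof.
apply/group_setP; split=> [|x y]; first by rewrite inE GL_1E det1.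
by rewrite !inE GL_MxE det_mulmx => /eqP-> /eqP->; rewrite mulr1.
Qed.

Canonical SL2_group (p : nat) : {group {'GL_2(p)}} := Group (SL2_group_set p).

(* Main.v *)
(** The argument is the pivot proof of growth. Let [S] be symmetric, generating and
    contain 1, and call [y] generic if its trace is none of 0, 2, -2.
    - A set of elements of [S^12] with the trace of a generic element has at most
      about [|S^36|^(2/3)] elements (Larsen-Pink): a triple [(x1, x2, x3)] of such
      elements is determined up to two choices by [x1 x2^-1] and [x3 x2^-1], since
      [x2] then lies on the intersection of a line with the quadric [det = 1],
      unless the three matrices share an eigenvector, and such triples are few.
    - By orbit-stabiliser, for generic [y] in [S^10] the centraliser of [y] therefore
      meets [S^2] in at least about [|S| / |S^36|^(2/3)] elements. If this number
      exceeds 4, the conjugate [C(y^a)], [a] in [S], contains a generic element of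
      [S^4], so it again meets [S^2] in that many elements. As [S] generates, this
      holds for all conjugates of [y].
    - There are about [p^2] conjugates, and each non-scalar matrix lies in at most
      two of their centralisers; counting [S^2] gives growth unless [|S|] is close
      to [p^3].
    Generic elements in [S^10] come from trace identities, and Ruzsa's triangle
    inequality passes from [A * A * A] to the powers of [S]. Iterating reaches sets
    of size [p^(3 - 1/8)]; for such a set [B], [B^2] contains many unipotent and many
    diagonal matrices, and a second-moment bound on point-line incidences shows that
    [B^10] contains every unipotent matrix, hence [B^40] is everything. *)
Require Import Defs.
From mathcomp Require Import all_boot all_order all_algebra all_fingroup.
From mathcomp Require Import reals exp.
From mathcomp Require Import ring lra zify.

Set Implicit Arguments.
Unset Strict Implicit.
Unset Printing Implicit Defensive.

Import GRing.Theory.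

(** * Product sets in finite groups *)

Lemma card_fibres (T U : finType) (f : T -> U) (D : {set T}) (C : {set U}) m :
  {in D, forall x, f x \in C} ->
  (forall y, y \in C -> #|[set x in D | f x == y]| <= m) ->
  #|D| <= m * #|C|.
Proof.
move=> fC fm; rewrite -sum1_card (partition_big f (mem C)) //= mulnC.
rewrite -sum_nat_const; apply: leq_sum => y yC.
by rewrite sum1dep_card; apply: leq_trans (fm y yC); rewrite cardsE.
Qed.

Lemma double_count (T U : finType) (D : {pred T}) (C : {pred U}) (r : T -> U -> bool) :
  \sum_(x in D) #|[set y in C | r x y]| = \sum_(y in C) #|[set x in D | r x y]|.
Proof.
have E (V : finType) (B : {pred V}) (p : pred V) :
    #|[set y in B | p y]| = \sum_(y in B) p y.
  rewrite -sum1_card (eq_bigl (fun y => (y \in B) && p y)); last first.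
    by move=> y; rewrite inE.
  by rewrite big_mkcondr; apply: eq_bigr => y _; case: (p y).
under eq_bigr do rewrite E; rewrite exchange_big.
by apply: eq_bigr => y _; rewrite E.
Qed.

Section Growth.
Variable gT : finGroupType.
Implicit Types (A B S X Y : {set gT}) (H : {group gT}).
Local Open Scope group_scope.

(** Fix one factorisation [w = x * y] of each [w] in [X * Y]. Then [(b, w)] is recovered from
    [(x * b, b^-1 * y)]: the product of the two components is [w], which determines [x] and then
    [b]. *)
Lemma ruzsa_triangle B X Y : #|B| * #|X * Y| <= #|X * B| * #|B^-1 * Y|.
Proof.
pose dec w := [pick u : gT * gT | [&& u.1 \in X, u.2 \in Y & w == u.1 * u.2]].
pose xw w := if dec w is Some u then u else (1, 1).
have xwP w : w \in X * Y -> [/\ (xw w).1 \in X, (xw w).2 \in Y & w = (xw w).1 * (xw w).2].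
  rewrite /xw /dec => /mulsgP[x y xX yY ->]; case: pickP => [u /and3P[? ? /eqP]|] //.
  by move/(_ (x, y)); rewrite xX yY eqxx.
pose f (u : gT * gT) := ((xw u.2).1 * u.1, u.1^-1 * (xw u.2).2).
rewrite -!cardsX -[X in _ <= X]mul1n.
apply: (card_fibres (f := f)) => [[b w]|[y z] _].
  rewrite inE => /andP[/= bB /xwP[xX yY _]].
  by rewrite !inE mem_mulg //= mem_mulg // inE invgK.
apply/card_le1_eqP => -[b w] [b' w']; rewrite !inE /= /f /=.
case/andP=> /andP[_ /xwP[_ _ wE]] /eqP[y1 z1].
case/andP=> /andP[_ /xwP[_ _ wE']] /eqP[y2 z2].
have ww : w = w'.
  by rewrite wE wE' -[in LHS](mulgK b (xw w).1) y1 -mulgA z1 -y2 -z2 -mulgA mulKVg.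
by move: y1; rewrite ww -y2 => /mulgI ->.
Qed.

Lemma expsg_subl S m n : 1 \in S -> m <= n -> S ^+ m \subset S ^+ n.
Proof.
move=> S1 /subnKC <-; rewrite expgD; apply: mulg_subl.
by elim: (n - m) => [|k IH]; rewrite ?expg0 ?set11 // expgS -(mulg1 1) mem_mulg.
Qed.

Lemma expsgS S X n : S \subset X -> S ^+ n \subset X ^+ n.
Proof. by move=> SX; elim: n => [|n IH]; rewrite ?expg0 // !expgS mulgSS. Qed.

Lemma invsg_exp S n : S^-1 = S -> (S ^+ n)^-1 = S ^+ n.
Proof.
move=> SV; elim: n => [|n IH]; first by rewrite expg0 invg1.
by rewrite expgS invMg IH SV -expgSr expgS.
Qed.

Lemma conjsVg S x : S^-1 :^ x = (S :^ x)^-1.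
Proof. by apply/setP => y; rewrite mem_invg !mem_conjg mem_invg conjVg. Qed.

Lemma conjsXg S x n : S ^+ n :^ x = (S :^ x) ^+ n.
Proof.
elim: n => [|n IH]; first by rewrite !expg0 conjs1g.
by rewrite !expgS conjsMg IH.
Qed.

(** The triangle inequality through [S], applied to [S ^+ 2] times the remaining power, costs one
    factor [#|S ^+ 3| / #|S|] per additional power. *)
Lemma small_tripling S n : S^-1 = S -> 
  #|S ^+ n.+3| * #|S| ^ n <= #|S ^+ 3| ^ n.+1.
Proof.
move=> SV; elim: n => [|n IH]; first by rewrite expn0 muln1 expn1.
have: #|S| * #|S ^+ n.+4| <= #|S ^+ n.+3| * #|S ^+ 3|.
  have -> : S ^+ n.+4 = S ^+ n.+2 * (S ^+ 2) by rewrite -expgD addn2.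
  apply: leq_trans (ruzsa_triangle _ _ _) _.
  by rewrite SV -expgSr -expgS.
move=> le1; rewrite expnS mulnA [(_ * #|S|)%N]mulnC.
apply: leq_trans (leq_mul le1 (leqnn _)) _.
by rewrite mulnAC [in X in _ <= X]expnSr leq_mul2r IH orbT.
Qed.

Lemma card_mulsV A B : #|A * B| = #|B^-1 * A^-1|.
Proof. by rewrite -invMg card_invg. Qed.

Lemma leq_card_mulsr X Y : Y != set0 -> #|X| <= #|X * Y|.
Proof.
case/set0Pn=> y yY; rewrite -(card_rcoset X y).
by apply/subset_leq_card/mulgS; rewrite sub1set.
Qed.

(** The cube is covered by the 27 three-letter words in [1], [A], [A^-1]. The triangle inequality,
    used twice for the alternating words, bounds each by [#|A * A * A| ^ 3 / #|A| ^ 2]. *)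
Lemma symmetrized_tripling A :
  #|(1 |: (A :|: A^-1)) ^+ 3| * #|A| ^ 2 <= 27 * #|A * A * A| ^ 3.
Proof.
have [->|A0] := eqVneq A set0; first by rewrite cards0 muln0.
set n := #|A|; set T := #|A * A * A|.
have n0 : 0 < n by rewrite card_gt0.
have AA : #|A * A| <= T by exact: leq_card_mulsr.
have nT : n <= T by apply: leq_trans AA; exact: leq_card_mulsr.
have sq X Y : n * #|X * Y| <= T * T -> n ^ 2 * #|X * Y| <= T ^ 3.
  by move=> le; rewrite -mulnA expnS leq_mul.
pose E (b : bool) := if b then A else A^-1.
have En b : E b != set0 by rewrite -card_gt0; case: b; rewrite /= ?card_invg.
have tri X B Y : n = #|B| -> n * #|X * Y| <= #|X * B| * #|B^-1 * Y|.
  by move->; exact: ruzsa_triangle.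
have nV : n = #|A^-1| by rewrite card_invg.
have h1 : n * #|A * A * A^-1| <= T * T.
  apply: leq_trans (tri _ A _ erefl) _.
  by rewrite leq_mul // -invMg card_invg.
have h1' : n * #|A * A^-1 * A^-1| <= T * T.
  by rewrite card_mulsV invMg invgK mulgA.
have h2 : n * #|A^-1 * A * A| <= T * T.
  rewrite -mulgA; apply: leq_trans (tri _ _ _ nV) _.
  by rewrite invgK mulgA leq_mul // -invMg card_invg.
have h2' : n * #|A^-1 * A^-1 * A| <= T * T.
  by rewrite -mulgA card_mulsV invMg invgK.
have h3 : n ^ 2 * #|A * A^-1 * A| <= T ^ 3.
  rewrite -mulnA; apply: leq_trans (leq_mul (leqnn _) (tri _ _ _ nV)) _.
  by rewrite invgK mulnA expnSr leq_mul.
have h3' : n ^ 2 * #|A^-1 * A * A^-1| <= T ^ 3.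
  by rewrite card_mulsV invMg !invgK mulgA.
have trip b1 b2 b3 : n ^ 2 * #|E b1 * E b2 * E b3| <= T ^ 3.
  have h0 : n ^ 2 * T <= T ^ 3 by rewrite [(T ^ 3)%N]expnSr leq_mul2r leq_exp2r // nT orbT.
  have hV : n ^ 2 * #|A^-1 * A^-1 * A^-1| <= T ^ 3.
    by rewrite card_mulsV invMg !invgK mulgA.
  case: b1; case: b2; case: b3; rewrite //= ?sq //.
have pair b1 b2 : n ^ 2 * #|E b1 * E b2| <= T ^ 3.
  by apply: leq_trans (trip b1 b2 true); rewrite leq_mul // leq_card_mulsr // (En true).
have sing b : n ^ 2 * #|E b| <= T ^ 3.
  by apply: leq_trans (pair b true); rewrite leq_mul // leq_card_mulsr // (En true).
have one : n ^ 2 * #|[1 gT]| <= T ^ 3.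
  by apply: leq_trans (sing true); rewrite cards1 leq_mul.
pose D (o : option bool) := if o is Some b then E b else 1.
have all3 i j k : n ^ 2 * #|D i * D j * D k| <= T ^ 3.
  by case: i j k => [i|] [j|] [k|]; rewrite /D ?mulg1 ?mul1g.
have -> : 1 |: (A :|: A^-1) = \bigcup_(i : option bool) D i.
  apply/setP=> x; rewrite !inE; apply/idP/bigcupP => [|[[[]|] _]].
  - case/or3P=> [/eqP->|xA|xA]; last by exists (Some false); rewrite /= ?inE.
      by exists None; rewrite ?set11.
    by exists (Some true).
  - by move=> /= ->; rewrite orbT.
  - by rewrite /= inE => ->; rewrite !orbT.
  by rewrite inE => ->.
set S := \bigcup_i D i.
have sub : S ^+ 3 \subset \bigcup_(i : option bool * option bool * option bool) (D i.1.1 * D i.1.2 * D i.2).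
  rewrite expgS expgS expg1 mulgA; apply/subsetP => w /mulsgP[v z /mulsgP[x y + + ->] + ->].
  move=> /bigcupP[i _ xi] /bigcupP[j _ yj] /bigcupP[k _ zk].
  by apply/bigcupP; exists (i, j, k); rewrite // !mem_mulg.
have card27 : (\sum_(i : option bool * option bool * option bool) T ^ 3 = 27 * T ^ 3)%N.
  by rewrite sum_nat_const !card_prod !card_option card_bool.
rewrite -card27 mulnC; apply: leq_trans (leq_mul (leqnn _) (subset_leq_card sub)) _.
apply: (@leq_trans (\sum_(i : option bool * option bool * option bool) (n ^ 2 * #|(D i.1.1 * D i.1.2 * D i.2)%g|))%N).
  rewrite -big_distrr leq_mul2l; apply/orP; right.
  elim/big_rec2: _ => [|i X y _]; first by rewrite cards0.
  by move=> le; apply: leq_trans (leq_card_setU _ _) _; rewrite leq_add2l.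
by apply: leq_sum => i _; exact: all3.
Qed.

(** Orbit-stabiliser for a subset: a fibre of [a |-> y ^ a], translated by the inverse of one of its
    members, lies in [A * A^-1] and centralises [y]. *)
Lemma leq_card_orbit A (C : {set gT}) y :
  {in A, forall a, y ^ a \in C} -> #|A| <= #|A * A^-1 :&: 'C[y]| * #|C|.
Proof.
move=> yA; apply: (card_fibres yA) => z _.
have [->|[a0]] := set_0Vmem [set a in A | y ^ a == z]; first by rewrite cards0.
rewrite inE => /andP[a0A /eqP ya0].
rewrite -(card_rcoset [set a in A | y ^ a == z] a0^-1); apply: subset_leq_card.
apply/subsetP=> _ /rcosetP[a + ->]; rewrite inE => /andP[aA /eqP ya].
rewrite in_setI mem_mulg ?mem_invg ?invgK //=; apply/cent1P/commute_sym/commgP/conjg_fixP.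
by rewrite conjgM ya -ya0 conjgK.
Qed.

(** Pigeonhole over left cosets of [H]: if [b * h = b0 * h0], then [b^-1 * b0] lies in
    [B^-1 * B :&: H] and determines the pair [(b, h)]. *)
Lemma leq_card_cosets B H (G : {group gT}) : B \subset G -> H \subset G ->
  #|B| * #|H| <= #|B^-1 * B :&: H| * #|G|.
Proof.
move=> BG HG; rewrite -cardsX.
apply: (card_fibres (f := fun u : gT * gT => u.1 * u.2)) => [[b h]|g _].
  by rewrite inE => /andP[/= /(subsetP BG) ? /(subsetP HG) ?]; rewrite groupM.
set D := [set u in _ | _].
have [->|[[b0 h0]]] := set_0Vmem D; first by rewrite cards0.
rewrite !inE /= => /andP[/andP[b0B h0H] /eqP gE].
rewrite -[X in _ <= X]mul1n.
apply: (card_fibres (f := fun u : gT * gT => u.1^-1 * b0)) => [[b h]|y _].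
  rewrite !inE /= => /andP[/andP[bB hH] /eqP bh].
  rewrite mem_mulg ?inE ?invgK //=.
  have -> : b^-1 * b0 = h * h0^-1 by rewrite -(mulKg b h) bh -gE -!mulgA mulgV mulg1.
  by rewrite groupM ?groupV.
apply/card_le1_eqP => -[b h] [b' h']; rewrite !inE /=.
case/andP=> /andP[_ /eqP bh] /eqP <- /andP[/andP[_ /eqP bh']] /eqP /mulIg /invg_inj bb.
by move: bh; rewrite -bh' bb => /mulgI ->.
Qed.
End Growth.

Local Open Scope ring_scope.

(** * Matrix coordinates *)

(* The interface of [{'GL_2[F]}] and its subgroup SL_2(F); it is abstract because
   unification on the concrete type keeps unfolding matrices. *)
Record matrix_model (F : finFieldType) := MatrixModel {
  carrier :> finGroupType;
  SL : {group carrier};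
  e00 : carrier -> F; e01 : carrier -> F; e10 : carrier -> F; e11 : carrier -> F;
  mk : F -> F -> F -> F -> carrier;
  ent_inj : forall g h, [/\ e00 g = e00 h, e01 g = e01 h, e10 g = e10 h & e11 g = e11 h] ->
    g = h;
  entM : forall g h,
    (e00 (g * h)%g = e00 g * e00 h + e01 g * e10 h) *
    (e01 (g * h)%g = e00 g * e01 h + e01 g * e11 h) *
    (e10 (g * h)%g = e10 g * e00 h + e11 g * e10 h) *
    (e11 (g * h)%g = e10 g * e01 h + e11 g * e11 h);
  ent1 : (e00 1%g = 1) * (e01 1%g = 0) * (e10 1%g = 0) * (e11 1%g = 1);
  mem_SL : forall g, (g \in SL) = (e00 g * e11 g - e01 g * e10 g == 1);
  mkP : forall a b c d, a * d - b * c = 1 ->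
    [/\ e00 (mk a b c d) = a, e01 (mk a b c d) = b, e10 (mk a b c d) = c
      & e11 (mk a b c d) = d]
}.

Arguments e00 {F m} g : rename.
Arguments e01 {F m} g : rename.
Arguments e10 {F m} g : rename.
Arguments e11 {F m} g : rename.

Section SpecialLinear.
Variables (F : finFieldType) (gT : matrix_model F).
Local Notation SL := (SL gT).
Implicit Types (g h x y u : gT) (A B S X Y : {set gT}).

Definition tr g := e00 g + e11 g.

Lemma SL_det g : g \in SL -> e00 g * e11 g - e01 g * e10 g = 1.
Proof. by rewrite mem_SL => /eqP. Qed.

Lemma mk_SL a b c d : a * d - b * c = 1 ->
  [/\ e00 (mk gT a b c d) = a, e01 (mk gT a b c d) = b, e10 (mk gT a b c d) = c
    & e11 (mk gT a b c d) = d] /\ mk gT a b c d \in SL.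
Proof.
move=> abcd; have [h0 h1 h2 h3] := mkP gT abcd.
by rewrite mem_SL h0 h1 h2 h3 abcd.
Qed.

Lemma entV g : g \in SL ->
  (e00 g^-1%g = e11 g) * (e01 g^-1%g = - e01 g) *
  (e10 g^-1%g = - e10 g) * (e11 g^-1%g = e00 g).
Proof.
move=> gSL; have [|[h0 h1 h2 h3] _] := @mk_SL (e11 g) (- e01 g) (- e10 g) (e00 g).
  by rewrite mulrNN mulrC SL_det.
suff -> : g^-1%g = mk gT (e11 g) (- e01 g) (- e10 g) (e00 g) by rewrite h0 h1 h2 h3.
apply/eqP; rewrite eq_invg_mul; apply/eqP/ent_inj.
rewrite !entM !ent1 h0 h1 h2 h3; have dg := SL_det gSL.
by split; rewrite -?dg; ring.
Qed.

Lemma trMC g h : tr (g * h)%g = tr (h * g)%g.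
Proof. by rewrite /tr !entM; ring. Qed.

Lemma trJ g h : tr (g ^ h)%g = tr g.
Proof. by rewrite conjgE trMC mulgK. Qed.

Lemma tr1 : tr (1%g : gT) = 1 + 1.
Proof. by rewrite /tr !ent1. Qed.

(** Cayley-Hamilton in the form [h^-1 = tr h - h]. *)
Lemma trMV g h : h \in SL -> tr (g * h^-1)%g = tr g * tr h - tr (g * h)%g.
Proof. by move=> hSL; rewrite /tr !entM !entV //; ring. Qed.

Definition is_scalar g := [&& e01 g == 0, e10 g == 0 & e00 g == e11 g].

(** Leaves a polynomial identity for [ring]: [a - b] is [k] times a known equation [c = d]. This is
    the source of the multipliers [k] given throughout. *)
Lemma eq_combr (k c d a b : F) : c = d -> a - b = k * (c - d) -> a = b.
Proof. by move=> ->; rewrite subrr mulr0 => /eqP; rewrite subr_eq0 => /eqP. Qed.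

Lemma eq_divr (m a b : F) : m != 0 -> m * a = m * b -> a = b.
Proof. by move=> m0 /(mulfI m0). Qed.

Lemma commuteE g h : commute g h <->
  [/\ e01 g * e10 h = e10 g * e01 h,
      e01 g * (e00 h - e11 h) = e01 h * (e00 g - e11 g)
    & e10 g * (e00 h - e11 h) = e10 h * (e00 g - e11 g)].
Proof.
split=> [gh|[h1 h2 h3]]; last first.
  apply: ent_inj; rewrite !entM; split.
  - by apply: (eq_combr (k := 1) h1); ring.
  - by apply: (eq_combr (k := -1) h2); ring.
  - by apply: (eq_combr (k := 1) h3); ring.
  - by apply: (eq_combr (k := -1) h1); ring.
have := congr1 e00 gh; have := congr1 e01 gh; have := congr1 e10 gh.
rewrite !entM => k10 k01 k00; split.
- by apply: (eq_combr (k := 1) k00); ring.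
- by apply: (eq_combr (k := -1) k01); ring.
- by apply: (eq_combr (k := 1) k10); ring.
Qed.

(** The traceless part of [g] is nonzero and that of [h] is parallel to it, with ratio [k]. The
    cases say which entry of [g] can be divided by. *)
Lemma commute_lin g h : ~~ is_scalar g -> commute g h -> exists k l : F,
  [/\ e00 h = k * e00 g + l, e01 h = k * e01 g, e10 h = k * e10 g
    & e11 h = k * e11 g + l].
Proof.
rewrite /is_scalar !negb_and => ng /commuteE[h1 h2 h3].
have [b0|b0] := eqVneq (e01 g) 0; last first.
  exists (e01 h / e01 g), (e00 h - e01 h / e01 g * e00 g).
  split; [ring| by field| |]; apply: (eq_divr b0).
    by apply: (eq_combr (k := 1) h1); field.
  by apply: (eq_combr (k := -1) h2); field.
have [c0|c0] := eqVneq (e10 g) 0; last first.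
  exists (e10 h / e10 g), (e00 h - e10 h / e10 g * e00 g).
  split; [ring| |by field|]; apply: (eq_divr c0).
    by apply: (eq_combr (k := -1) h1); field.
  by apply: (eq_combr (k := -1) h3); field.
move: ng h2 h3; rewrite b0 c0 !eqxx /= -subr_eq0 !mul0r => d0 h2 h3.
have {h2} hb : e01 h = 0 by apply: (eq_divr d0); rewrite mulrC -h2 mulr0.
have {h3} hc : e10 h = 0 by apply: (eq_divr d0); rewrite mulrC -h3 mulr0.
exists ((e00 h - e11 h) / (e00 g - e11 g)).
exists (e00 h - (e00 h - e11 h) / (e00 g - e11 g) * e00 g).
by split; [ring | rewrite hb mulr0 | rewrite hc mulr0 | field].
Qed.

Lemma commute_trans g h y :
  ~~ is_scalar h -> commute g h -> commute h y -> commute g y.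
Proof.
move=> nh /commute_sym gh hy.
have [k [l [a1 a2 a3 a4]]] := commute_lin nh gh.
have [k' [l' [b1 b2 b3 b4]]] := commute_lin nh hy.
by apply/commuteE; rewrite a1 a2 a3 a4 b1 b2 b3 b4; split; ring.
Qed.

Lemma scalar_SL g : g \in SL -> is_scalar g -> (g == 1%g) || (tr g == - (1 + 1)) && (e00 g == -1).
Proof.
move=> /SL_det dg /and3P[/eqP b0 /eqP c0 /eqP ad]; move: dg.
rewrite b0 c0 mulr0 subr0 ad => /eqP; rewrite -expr2 sqrf_eq1 => /orP[] /eqP d1.
  by apply/orP; left; apply/eqP/ent_inj; rewrite !ent1 ad.
by rewrite /tr ad d1 opprD !eqxx orbT.
Qed.

(** The discriminant [tr g ^+ 2 - 4] of the characteristic polynomial is nonzero, so the eigenvalues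
    are distinct. *)
Definition regular g := tr g ^+ 2 != (1 + 1) ^+ 2.

Lemma regular_nscalar g : g \in SL -> regular g -> ~~ is_scalar g.
Proof.
move=> gSL; apply: contra => /(scalar_SL gSL)/orP[/eqP ->|/andP[/eqP-> _]].
  by rewrite tr1.
by rewrite sqrrN.
Qed.

(** Both elements lie in the plane spanned by [g] and the identity, where the discriminant is
    [k ^+ 2] times that of [g]. Equal traces force [k' = k] or [k' = - k]; the trace then fixes the
    scalar part, and the second sign gives the inverse. *)
Lemma commuting_same_trace g h h' :
  (1 + 1 != 0 :> F) -> ~~ is_scalar g -> g \in SL -> h \in SL -> h' \in SL ->
  commute g h -> commute g h' -> regular h -> tr h' = tr h -> h' = h \/ h' = h^-1%g.
Proof.
move=> two_neq0 ng gSL hSL h'SL gh gh' rh tt.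
have [k [l [a1 a2 a3 a4]]] := commute_lin ng gh.
have [k' [l' [b1 b2 b3 b4]]] := commute_lin ng gh'.
have dg := SL_det gSL; have dh := SL_det hSL; have dh' := SL_det h'SL.
pose D := tr g ^+ 2 - (1 + 1) ^+ 2.
have disc x : x \in SL -> tr x ^+ 2 - (1 + 1) ^+ 2 = (e00 x - e11 x) ^+ 2 + (1 + 1) ^+ 2 * e01 x * e10 x.
  by move=> /SL_det dx; rewrite /tr; apply: (eq_combr (k := (1 + 1) ^+ 2) dx); ring.
have kD : tr h ^+ 2 - (1 + 1) ^+ 2 = k ^+ 2 * D.
  by rewrite disc // /D disc // a1 a2 a3 a4; ring.
have k'D : tr h ^+ 2 - (1 + 1) ^+ 2 = k' ^+ 2 * D.
  by rewrite -tt disc // /D disc // b1 b2 b3 b4; ring.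
have D0 : D != 0 by apply: contra rh => /eqP D0; rewrite -subr_eq0 kD D0 mulr0.
have /eqP : k' ^+ 2 = k ^+ 2 by apply: (mulIf D0); rewrite -kD -k'D.
rewrite eqf_sqr => /orP[] /eqP kk.
  left; have ll : l' = l.
    apply: (eq_divr two_neq0); move: tt; rewrite /tr b1 b4 a1 a4 kk => tt.
    by apply: (eq_combr (k := 1) tt); ring.
  by apply: ent_inj; rewrite a1 a2 a3 a4 b1 b2 b3 b4 kk ll.
right; apply: ent_inj; rewrite !entV // a1 a2 a3 a4 b1 b2 b3 b4 kk.
move: tt; rewrite /tr b1 b4 a1 a4 kk => tt.
by split; try ring; apply: (eq_divr two_neq0); apply: (eq_combr (k := 1) tt); ring.
Qed.

(** Here [h = k g + l] with [k] nonzero, and the discriminant of [h] is [k ^+ 2] times that of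
    [g]. *)
Lemma regular_commute g h : g \in SL -> h \in SL -> regular g -> commute g h ->
  ~~ is_scalar h -> regular h.
Proof.
move=> gSL hSL rg gh nh.
have [k [l [a1 a2 a3 a4]]] := commute_lin (regular_nscalar gSL rg) gh.
have disc x : x \in SL -> tr x ^+ 2 - (1 + 1) ^+ 2 = (e00 x - e11 x) ^+ 2 + (1 + 1) ^+ 2 * e01 x * e10 x.
  by move=> /SL_det dx; rewrite /tr; apply: (eq_combr (k := (1 + 1) ^+ 2) dx); ring.
have k0 : k != 0.
  by apply: contra nh => /eqP k0; rewrite /is_scalar a1 a2 a3 a4 k0 !mul0r !eqxx.
rewrite /regular -subr_eq0 disc // a1 a2 a3 a4.
suff -> : (k * e00 g + l - (k * e11 g + l)) ^+ 2 + (1 + 1) ^+ 2 * (k * e01 g) * (k * e10 g) = k ^+ 2 * (tr g ^+ 2 - (1 + 1) ^+ 2).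
  by rewrite mulf_neq0 ?expf_neq0 // subr_eq0.
by rewrite disc //; ring.
Qed.

End SpecialLinear.

(** * Lines and the Larsen-Pink inequality *)

Section Lines.
Variables (F : finFieldType) (gT : matrix_model F).
Local Notation SL := (SL gT).
Implicit Types (g h x y u v w : gT) (A B S X Y : {set gT}) (L : option F).

Definition upper : {set gT} := [set g in SL | e10 g == 0].

Lemma upper_group_set : group_set upper.
Proof.
apply/group_setP; split=> [|x y]; first by rewrite inE group1 /= ent1.
move=> /setIdP[xSL /eqP x0] /setIdP[ySL /eqP y0].
by apply/setIdP; rewrite groupM //= !entM x0 y0 mul0r mulr0 addr0.
Qed.

Canonical upper_group : {group gT} := Group upper_group_set.

(* [L] is a point of the projective line, [None] being the point at infinity;
   [to_line L] maps the line at infinity to [L], so [borel L] is the stabiliser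
   of [L]. *)
Definition to_line L : gT := if L is Some s then mk gT s (-1) 1 0 else 1%g.

Lemma to_line_SL L : to_line L \in SL.
Proof.
case: L => [s|] /=; last exact: group1.
by have [|_ ->] := @mk_SL F gT s (-1) 1 0; first ring.
Qed.

Lemma mem_upper g : (g \in upper) = (g \in SL) && (e10 g == 0).
Proof. exact: in_set. Qed.

Definition borel L : {set gT} := [set g | (g ^ to_line L)%g \in upper].

Lemma mem_borel L g : (g \in borel L) = ((g ^ to_line L)%g \in upper).
Proof. exact: in_set. Qed.

Lemma borel_group_set L : group_set (borel L).
Proof.
apply/group_setP; split=> [|x y]; first by rewrite mem_borel conj1g group1.
by rewrite !mem_borel conjMg; exact: groupM.
Qed.

Canonical borel_group L : {group gT} := Group (borel_group_set L).

Lemma borelN g : (g \in borel None) = (g \in SL) && (e10 g == 0).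
Proof. by rewrite mem_borel conjg1 mem_upper. Qed.

(** The quadratic is the fixed-point equation of [s] under the Moebius action of [g]. *)
Lemma borelS g s : (g \in borel (Some s)) =
  (g \in SL) && (e10 g * s ^+ 2 + (e11 g - e00 g) * s - e01 g == 0).
Proof.
rewrite mem_borel mem_upper groupJr; last exact: (to_line_SL (Some s)).
congr (_ && (_ == 0)); rewrite conjgE /=.
have [|[h0 h1 h2 h3] mSL] := @mk_SL F gT s (-1) 1 0; first ring.
by rewrite !entM !entV // h0 h2; ring.
Qed.

Lemma borel_SL L : borel L \subset SL.
Proof.
apply/subsetP => x; case: L => [s|]; first by rewrite borelS; case/andP.
by rewrite borelN; case/andP.
Qed.

Lemma borel_proper L : borel L \proper SL.
Proof.
apply/properP; split; first exact: borel_SL.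
case: L => [s|].
  have [|[h0 h1 h2 h3] mSL] := @mk_SL F gT 1 1 0 1; first ring.
  exists (mk gT 1 1 0 1) => //; rewrite borelS h0 h1 h2 h3.
  by rewrite mul0r subrr mul0r !add0r oppr_eq0 oner_eq0 andbF.
have [|[h0 h1 h2 h3] mSL] := @mk_SL F gT 1 0 1 1; first ring.
by exists (mk gT 1 0 1 1) => //; rewrite borelN h2 oner_eq0 andbF.
Qed.

(** Fixed points on the projective line are roots of a quadratic form whose coefficients all vanish
    only for scalar [g]. Fact [three] treats three finite points; [two] treats two finite points
    together with infinity, where [e10 g = 0]. *)
Lemma card_borels g : ~~ is_scalar g -> (#|[set L | g \in borel L]| <= 2)%N.
Proof.
move=> ng; rewrite leqNgt; apply/negP => /card_gt2P[x [y [z [[]]]]].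
have sB L : (L \in [set L | g \in borel L]) = (g \in borel L) by exact: in_set.
rewrite !sB => gx gy gz [xy yz zx]; move/negP: ng; apply.
have two s t : s != t -> e10 g = 0 -> g \in borel (Some s) -> g \in borel (Some t) -> is_scalar g.
  rewrite /is_scalar !borelS => st -> /andP[_ /eqP hs] /andP[_ /eqP ht].
  have ad : e00 g = e11 g.
    apply: (@eq_divr _ (s - t)); first by rewrite subr_eq0.
    have e: 0 * s ^+ 2 + (e11 g - e00 g) * s - e01 g = 0 * t ^+ 2 + (e11 g - e00 g) * t - e01 g by rewrite hs ht.
    by apply: (eq_combr (k := -1) e); ring.
  have b0 : e01 g = 0 by apply: (eq_combr (k := -1) hs); rewrite ad; ring.
  by rewrite ad b0 !eqxx.
have three s t r : s != t -> t != r -> r != s -> g \in borel (Some s) ->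
    g \in borel (Some t) -> g \in borel (Some r) -> is_scalar g.
  move=> st tr rs gs gt gr; apply: (two s t) => //.
  move: gs gt gr; rewrite !borelS => /andP[_ /eqP hs] /andP[_ /eqP ht] /andP[_ /eqP hr].
  have div a b : a != b -> e10 g * a ^+ 2 + (e11 g - e00 g) * a - e01 g = 0 ->
     e10 g * b ^+ 2 + (e11 g - e00 g) * b - e01 g = 0 -> e10 g * (a + b) + (e11 g - e00 g) = 0.
    move=> ab ha hb; apply: (@eq_divr _ (a - b)); first by rewrite subr_eq0.
    have e := etrans ha (esym hb).
    by apply: (eq_combr (k := 1) e); ring.
  apply: (@eq_divr _ (r - s)); first by rewrite subr_eq0.
  have e := etrans (div _ _ tr ht hr) (esym (div _ _ st hs ht)).
  by apply: (eq_combr (k := 1) e); ring.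
case: x y z gx gy gz xy yz zx => [x|] [y|] [z|] gx gy gz xy yz zx //.
- exact: (three x y z).
- by move: gz; rewrite borelN => /andP[_ /eqP gz]; apply: (two x y).
- by move: gy; rewrite borelN => /andP[_ /eqP gy]; apply: (two z x).
- by move: gx; rewrite borelN => /andP[_ /eqP gx]; apply: (two y z).
Qed.

Lemma parallelP (a1 a2 a3 b1 b2 b3 : F) : [|| a1 != 0, a2 != 0 | a3 != 0] ->
  a1 * b2 = a2 * b1 -> a1 * b3 = a3 * b1 -> a2 * b3 = a3 * b2 ->
  exists k, [/\ b1 = k * a1, b2 = k * a2 & b3 = k * a3].
Proof.
move=> nz h12 h13 h23; case/or3P: nz => nz.
- by exists (b1 / a1); split; first field; rewrite // mulrAC [b1 * _]mulrC ?(h12, h13) -?h12 -?h13 mulrC mulKf.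
- exists (b2 / a2); split; last 1 first.
  + by rewrite mulrAC [b2 * _]mulrC -h23 mulrC mulKf.
  + by rewrite mulrAC [b2 * _]mulrC h12 mulrC mulKf.
  + by field.
exists (b3 / a3); split.
- by rewrite mulrAC [b3 * _]mulrC h13 mulrC mulKf.
- by rewrite mulrAC [b3 * _]mulrC h23 mulrC mulKf.
- by field.
Qed.

(** If the cross product of [a] and [b] is nonzero, it spans their orthogonal complement, which
    contains [x] and [y]; otherwise [a] and [b] are parallel. *)
Lemma perp_parallel (a1 a2 a3 b1 b2 b3 x1 x2 x3 y1 y2 y3 : F) :
  [|| x1 != 0, x2 != 0 | x3 != 0] ->
  x1 * a1 + x2 * a2 + x3 * a3 = 0 -> x1 * b1 + x2 * b2 + x3 * b3 = 0 ->
  y1 * a1 + y2 * a2 + y3 * a3 = 0 -> y1 * b1 + y2 * b2 + y3 * b3 = 0 ->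
  (exists s, [/\ y1 = s * x1, y2 = s * x2 & y3 = s * x3]) \/
  [/\ a1 * b2 = a2 * b1, a1 * b3 = a3 * b1 & a2 * b3 = a3 * b2].
Proof.
move=> x0 xa xb ya yb.
pose n1 := a2 * b3 - a3 * b2; pose n2 := a3 * b1 - a1 * b3; pose n3 := a1 * b2 - a2 * b1.
have [n0|] := boolP [|| n1 != 0, n2 != 0 | n3 != 0]; last first.
  rewrite !negb_or !negbK !subr_eq0 => /and3P[/eqP h1 /eqP h2 /eqP h3].
  by right; rewrite h1 h2 h3.
left.
have par z1 z2 z3 : z1 * a1 + z2 * a2 + z3 * a3 = 0 -> z1 * b1 + z2 * b2 + z3 * b3 = 0 ->
    exists k, [/\ z1 = k * n1, z2 = k * n2 & z3 = k * n3].
  move=> za zb.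
  apply: parallelP => //; apply/eqP; rewrite -subr_eq0; apply/eqP; rewrite /n1 /n2 /n3.
  - transitivity (b3 * (z1 * a1 + z2 * a2 + z3 * a3) - a3 * (z1 * b1 + z2 * b2 + z3 * b3)); first ring.
    by rewrite za zb !mulr0 subrr.
  - transitivity (a2 * (z1 * b1 + z2 * b2 + z3 * b3) - b2 * (z1 * a1 + z2 * a2 + z3 * a3)); first ring.
    by rewrite za zb !mulr0 subrr.
  - transitivity (b1 * (z1 * a1 + z2 * a2 + z3 * a3) - a1 * (z1 * b1 + z2 * b2 + z3 * b3)); first ring.
    by rewrite za zb !mulr0 subrr.
have [k [k1 k2 k3]] := par _ _ _ xa xb.
have [l [l1 l2 l3]] := par _ _ _ ya yb.
have kn0 : k != 0.
  by apply: contraL x0 => /eqP k0; rewrite k1 k2 k3 k0 !mul0r eqxx.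
by exists (l / k); rewrite k1 k2 k3 l1 l2 l3; split; field.
Qed.

(** The matrix [d] with rows [(d1, d2)] and [(d3, - d1)] is nilpotent of rank one, and its kernel
    equals its image [L]. The linear condition says [tr (d g) = 0], that is, [g] maps [L] into the
    kernel of [d]. *)
Lemma nilpotent_line (d1 d2 d3 : F) : [|| d1 != 0, d2 != 0 | d3 != 0] ->
  d1 ^+ 2 + d2 * d3 = 0 ->
  exists L, forall g, g \in SL ->
    d1 * (e00 g - e11 g) + d2 * e10 g + d3 * e01 g = 0 -> g \in borel L.
Proof.
move=> d0 dd; have [d30|d30] := eqVneq d3 0.
  have d10 : d1 = 0.
    by move: dd; rewrite d30 mulr0 addr0 => /eqP; rewrite sqrf_eq0 => /eqP.
  exists None => g gSL; rewrite borelN gSL; move: d0.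
  rewrite d10 d30 eqxx orbF /= mul0r add0r mul0r addr0 => d20 /eqP.
  by rewrite mulf_eq0 (negPf d20).
exists (Some (d1 / d3)) => g gSL h; rewrite borelS gSL; apply/eqP.
apply: (@eq_divr _ (d3 ^+ 2)); first by rewrite expf_neq0.
transitivity (e10 g * (d1 ^+ 2 + d2 * d3) -
   d3 * (d1 * (e00 g - e11 g) + d2 * e10 g + d3 * e01 g)); first by field.
by rewrite h dd !mulr0 subrr.
Qed.

(* A line meeting the quadric [det = 1] in three points lies in it, so its
   direction is nilpotent. *)
Lemma collinear_line u v w (s : F) : u \in SL -> v \in SL -> w \in SL ->
  tr v = tr u -> tr w = tr u -> u != v -> v != w -> u != w ->
  e00 w - e00 u = s * (e00 v - e00 u) ->
  e01 w - e01 u = s * (e01 v - e01 u) ->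
  e10 w - e10 u = s * (e10 v - e10 u) ->
  exists L, [/\ u \in borel L, v \in borel L, w \in borel L &
    forall g, g \in SL -> (e00 v - e00 u) * (e00 g - e11 g) + (e01 v - e01 u) * e10 g
      + (e10 v - e10 u) * e01 g = 0 -> g \in borel L].
Proof.
move=> uSL vSL wSL tv tw uv vw uw.
set d1 := e00 v - _; set d2 := e01 v - _; set d3 := e10 v - _ => w1 w2 w3.
have v00 : e00 v = e00 u + d1 by rewrite /d1; ring.
have v01 : e01 v = e01 u + d2 by rewrite /d2; ring.
have v10 : e10 v = e10 u + d3 by rewrite /d3; ring.
have v11 : e11 v = e11 u - d1.
  by apply: (eq_combr (k := 1) tv); rewrite /tr /d1; ring.
have w00 : e00 w = e00 u + s * d1 by rewrite -w1; ring.
have w01 : e01 w = e01 u + s * d2 by rewrite -w2; ring.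
have w10 : e10 w = e10 u + s * d3 by rewrite -w3; ring.
have w11 : e11 w = e11 u - s * d1.
  by apply: (eq_combr (k := 1) tw); rewrite /tr w00; ring.
clearbody d1 d2 d3.
have d0 : [|| d1 != 0, d2 != 0 | d3 != 0].
  apply: contraR uv; rewrite !negb_or !negbK => /and3P[/eqP z1 /eqP z2 /eqP z3].
  by apply/eqP/ent_inj; rewrite v00 v01 v10 v11 z1 z2 z3 subr0 !addr0.
have s0 : s != 0.
  apply: contra uw => /eqP z; apply/eqP/ent_inj.
  by rewrite w00 w01 w10 w11 z !mul0r subr0 !addr0.
have s1 : s - 1 != 0.
  rewrite subr_eq0; apply: contra vw => /eqP z; apply/eqP/ent_inj.
  by rewrite w00 w01 w10 w11 v00 v01 v10 v11 z !mul1r.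
have du := SL_det uSL; have dv := SL_det vSL; have dw := SL_det wSL.
(* Along the direction [d] the determinant is [det (u + s d) = 1 - s l - s^2 q]. Its value 1 at [v]
   and at [w] gives two equations that force [l = q = 0]. *)
pose q := d1 ^+ 2 + d2 * d3.
pose l := d1 * (e00 u - e11 u) + d2 * e10 u + d3 * e01 u.
have lq : l + q = 0.
  have e := etrans du (esym dv).
  by apply: (eq_combr (k := 1) e); rewrite v00 v01 v10 v11 /l /q; ring.
have lsq : l + s * q = 0.
  have e := etrans du (esym dw); apply: (eq_divr s0).
  by apply: (eq_combr (k := 1) e); rewrite w00 w01 w10 w11 /l /q; ring.
have q0 : q = 0.
  have e := etrans lsq (esym lq); apply: (eq_divr s1).
  by apply: (eq_combr (k := 1) e); ring.
have l0 : l = 0 by rewrite -[RHS]lq q0 addr0.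
have [L LP] := nilpotent_line d0 q0.
exists L; split=> //; first exact: LP.
  apply: LP => //; rewrite v00 v01 v10 v11.
  by transitivity (l + (1 + 1) * q); [rewrite /l /q; ring | rewrite l0 q0 mulr0 addr0].
apply: LP => //; rewrite w00 w01 w10 w11.
by transitivity (l + (1 + 1) * s * q); [rewrite /l /q; ring | rewrite l0 q0 mulr0 addr0].
Qed.

(** The differences [v - u] and [w - u] are orthogonal to the traceless parts of [g1] and [g3].
    Either [u], [v], [w] are collinear, or those traceless parts are parallel and then [u], [g1 u],
    [g3 u] are collinear; [collinear_line] concludes in both cases. *)
Lemma good_fibre (t : F) g1 g3 u v w : 1 + 1 != 0 :> F -> t != 0 ->
  {in [:: u; v; w; g1; g3], forall x, x \in SL} ->
  {in [:: u; v; w], forall x, [/\ tr x = t, tr (g1 * x)%g = t & tr (g3 * x)%g = t]} ->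
  u != v -> v != w -> u != w -> g1 != 1%g -> g3 != 1%g -> g1 != g3 ->
  exists L, [/\ u \in borel L, (g1 * u)%g \in borel L & (g3 * u)%g \in borel L].
Proof.
move=> two t0 inSL inT uv vw uw n1 n3 n13.
have [] : [/\ u \in SL, v \in SL, w \in SL, g1 \in SL & g3 \in SL].
  by split; apply: inSL; rewrite !inE eqxx ?orbT.
move=> uSL vSL wSL g1SL g3SL {inSL}.
have [tu tu1 tu3] := inT u (mem_head _ _).
have [] := inT v; first by rewrite !inE eqxx orbT.
move=> tv tv1 tv3.
have [] := inT w; first by rewrite !inE eqxx !orbT.
move=> tw tw1 tw3 {inT}.
have perp g x : tr x = t -> tr (g * x)%g = t -> tr (g * u)%g = t ->
   (e00 x - e00 u) * (e00 g - e11 g) + (e01 x - e01 u) * e10 g + (e10 x - e10 u) * e01 g = 0.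
  move=> tx tgx tgu; have e := etrans tgx (esym tgu); have e' := etrans tx (esym tu).
  transitivity (tr (g * x)%g - tr (g * u)%g - e11 g * (tr x - tr u)).
    by rewrite /tr !entM; ring.
  by rewrite e e' !subrr mulr0 subr0.
have d0 : [|| e00 v - e00 u != 0, e01 v - e01 u != 0 | e10 v - e10 u != 0].
  apply: contraR uv; rewrite !negb_or !negbK !subr_eq0 => /and3P[/eqP z1 /eqP z2 /eqP z3].
  apply/eqP/ent_inj; rewrite z1 z2 z3; split=> //.
  by apply: (eq_combr (k := 1) (etrans tu (esym tv))); rewrite /tr z1; ring.
have [[s [s1 s2 s3]]|[c1 c2 c3]] := perp_parallel d0 (perp g1 v tv tv1 tu1) (perp g3 v tv tv3 tu3)
   (perp g1 w tw tw1 tu1) (perp g3 w tw tw3 tu3).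
  have [] := collinear_line uSL vSL wSL _ _ uv vw uw s1 s2 s3; rewrite ?tu //.
  move=> L [uL _ _ LP]; exists L; split=> //.
    by rewrite (groupMr _ uL); apply: LP => //; apply: perp.
  by rewrite (groupMr _ uL); apply: LP => //; apply: perp.
(* A scalar [g1] other than 1 is -1, which would give [t = - t]. *)
have ns : [|| e00 g1 - e11 g1 != 0, e10 g1 != 0 | e01 g1 != 0].
  apply: contraR t0; rewrite !negb_or !negbK subr_eq0 => /and3P[/eqP z1 /eqP z2 /eqP z3].
  have : is_scalar g1 by rewrite /is_scalar z1 z2 z3 !eqxx.
  move=> /(scalar_SL g1SL); rewrite (negPf n1) /= => /andP[_ /eqP z0].
  have tt : (1 + 1) * t = 0.
    move: tu1; rewrite -tu /tr !entM z2 z3 -z1 z0 => tt.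
    by apply: (eq_combr (k := -1) tt); ring.
  by move/eqP: tt; rewrite mulf_eq0 (negPf two).
have [|||k [k1 k2 k3]] := parallelP ns (b1 := e00 g3 - e11 g3) (b2 := e10 g3) (b3 := e01 g3) => //.
pose l := e00 g3 - k * e00 g1.
have u3 : [/\ e00 (g3 * u)%g = k * e00 (g1 * u)%g + l * e00 u,
    e01 (g3 * u)%g = k * e01 (g1 * u)%g + l * e01 u,
    e10 (g3 * u)%g = k * e10 (g1 * u)%g + l * e10 u &
    e11 (g3 * u)%g = k * e11 (g1 * u)%g + l * e11 u].
  have g3d : e11 g3 = k * e11 g1 + l by apply: (eq_combr (k := -1) k1); rewrite /l; ring.
  have g3a : e00 g3 = k * e00 g1 + l by rewrite /l; ring.
  by rewrite !entM g3a g3d k2 k3; split; ring.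
have [a00 a01 a10 a11] := u3.
(* As [u], [g1 u] and [g3 u] all have trace [t], the relation [g3 u = k (g1 u) + l u] is an affine
   combination. *)
have kl : l = 1 - k.
  apply: (eq_divr t0); move: tu3; rewrite /tr a00 a11 => tu3.
  have -> : t * l = l * tr u by rewrite tu mulrC.
  transitivity (k * e00 (g1 * u)%g + l * e00 u + (k * e11 (g1 * u)%g + l * e11 u) - k * tr (g1 * u)%g).
    by rewrite /tr; ring.
  by rewrite tu3 tu1; ring.
rewrite kl in a00 a01 a10 a11.
have [|||||||||||L [uL u1L u3L _]] := @collinear_line u (g1 * u)%g (g3 * u)%g k.
- exact: uSL.
- exact: groupM.
- exact: groupM.
- by rewrite tu.
- by rewrite tu.
- by apply: contra n1 => /eqP e; apply/eqP/(mulIg u); rewrite mul1g.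
- by apply: contra n13 => /eqP /mulIg ->.
- by apply: contra n3 => /eqP e; apply/eqP/(mulIg u); rewrite mul1g.
- by rewrite a00; ring.
- by rewrite a01; ring.
- by rewrite a10; ring.
by exists L.
Qed.

(** The trace leaves two possible diagonals, recorded by one bit per factor, hence the 4. With the
    diagonals known and [e10 a] nonzero, the top left entry of [x a y] yields [e01 x]; so [x], and
    then [y], is determined. *)
Lemma card_upper_trace (t : F) X a :
  X \subset upper -> {in X, forall x, tr x = t} -> a \in SL -> a \notin upper ->
  (#|X| ^ 2 <= 4 * #|(X * [set a] * X)%g|)%N.
Proof.
move=> XU Xt aSL aU.
have [->|[x0 x0X]] := set_0Vmem X; first by rewrite cards0.
have a0 : e10 a != 0 by apply: contra aU => a0; rewrite mem_upper aSL.
have XP x : x \in X -> [/\ e10 x = 0, e00 x * e11 x = 1 & e11 x = t - e00 x].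
  move=> xX; have /setIdP[xSL /eqP x10] := subsetP XU x xX.
  by rewrite -(Xt x xX) -(SL_det xSL) x10 /tr; split=> //; ring.
have eig x : x \in X -> e00 x != e00 x0 -> e00 x = t - e00 x0.
  move=> xX ne; have [_ e1 e2] := XP x xX; have [_ f1 f2] := XP x0 x0X.
  apply: (@eq_divr _ (e00 x - e00 x0)); first by rewrite subr_eq0.
  rewrite e2 in e1; rewrite f2 in f1.
  by apply: (eq_combr (k := -1) (etrans e1 (esym f1))); ring.
have eigE x y : x \in X -> y \in X -> (e00 x == e00 x0) = (e00 y == e00 x0) -> e00 x = e00 y.
  move=> xX yX; have [-> /esym/eqP //|nx] := eqVneq (e00 x) (e00 x0).
  by move=> /esym/negbT/(eig y yX) ->; rewrite (eig x).
pose f (u : gT * gT) := ((u.1 * a * u.2)%g, (e00 u.1 == e00 x0, e00 u.2 == e00 x0)).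
rewrite -mulnn -cardsX -[X in (_ <= X)%N]mul1n.
have -> : (4 * #|(X * [set a] * X)%g| = #|setX (X * [set a] * X)%g [set: bool * bool]|)%N.
  by rewrite cardsX cardsT card_prod card_bool mulnC.
apply: (card_fibres (f := f)) => [[x y]|z _].
  by rewrite !in_setX => /andP[/= xX yX]; rewrite in_setT !mem_mulg ?set11.
apply/card_le1_eqP => -[x y] [x' y'].
move=> /setIdP[+ /eqP <-] /setIdP[]; rewrite !in_setX => /andP[/= xX yX] /andP[/= xX' yX'].
case/eqP=> zz ex ey.
have {ex}ex := eigE _ _ xX' xX ex; have {ey}ey := eigE _ _ yX' yX ey.
have [x1 x2 x3] := XP _ xX; have [x1' x2' x3'] := XP _ xX'.
have [y1 y2 y3] := XP _ yX; have [y1' y2' y3'] := XP _ yX'.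
have y00 : e00 y != 0 by apply/negP => /eqP h; move/eqP: y2; rewrite h mul0r eq_sym oner_eq0.
suff xx : x' = x by move: zz; rewrite xx => /mulgI ->.
apply: ent_inj; rewrite x3 x3' x1 x1' ex; split=> //.
apply: (@eq_divr _ (e10 a * e00 y)); first by rewrite mulf_neq0.
have := congr1 e00 zz; rewrite !entM y1 y1' ex ey => h.
by apply: (eq_combr (k := 1) h); ring.
Qed.

Lemma card_borel_trace (t : F) X a L :
  X \subset borel L -> {in X, forall x, tr x = t} -> a \in SL -> a \notin borel L ->
  (#|X| ^ 2 <= 4 * #|(X * [set a] * X)%g|)%N.
Proof.
move=> XL Xt aSL aL; set g := to_line L.
have := @card_upper_trace t (X :^ g)%g (a ^ g)%g; rewrite -conjg_set1 -!conjsMg !cardJg; apply.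
- apply/subsetP => _ /imsetP[x xX ->].
  by rewrite -mem_borel (subsetP XL).
- by move=> _ /imsetP[x xX ->]; rewrite trJ Xt.
- by rewrite groupJ // to_line_SL.
- by rewrite -mem_borel.
Qed.

(** The triples in [X] split into those with two equal entries, at most [3 N^2], those inside one
    Borel subgroup, at most [8 N^2], and the others, at most [2 N^2]. *)
Lemma larsen_pink_trace (t : F) X N :
  1 + 1 != 0 :> F -> t != 0 -> t ^+ 2 != (1 + 1) ^+ 2 ->
  X \subset SL -> {in X, forall x, tr x = t} -> (#|(X * X^-1)%g| <= N)%N ->
  (forall L, exists2 a, a \in SL :\: borel L & (#|(X * [set a] * X)%g| <= N)%N) ->
  (#|X| ^ 3 <= 13 * N ^ 2)%N.
Proof.
move=> two t0 treg XSL Xt XV XL.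
have nsX x : x \in X -> ~~ is_scalar x.
  by move=> xX; rewrite regular_nscalar ?(subsetP XSL) // /regular Xt.
have [->|X0] := eqVneq X set0; first by rewrite cards0.
have XN : (#|X| <= N)%N.
  by apply: leq_trans (leq_card_mulsr _ _) XV; rewrite -card_gt0 card_invg card_gt0.
pose D := setX (setX X X) X.
pose badL := \bigcup_L setX (setX (X :&: borel L) (X :&: borel L)) (X :&: borel L).
pose E := [set u in D | (u.1.1 == u.1.2) || (u.1.2 == u.2) || (u.1.1 == u.2)].
pose good := D :\: (badL :|: E).
have cardE : (#|E| <= 3 * N ^ 2)%N.
  pose XX := setX X X.
  have sub : E \subset (((fun v : gT * gT => (v.1, v.1, v.2)) @: XX) :|:
     ((fun v : gT * gT => (v.1, v.2, v.2)) @: XX)) :|: ((fun v : gT * gT => (v.1, v.2, v.1)) @: XX).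
    apply/subsetP => -[[x y] z] /setIdP[]; rewrite !in_setX /= => /andP[/andP[xX yX] zX].
    rewrite !in_setU; case/orP=> [/orP[]|] /eqP e.
    + by apply/orP; left; apply/orP; left; apply/imsetP; exists (x, z); rewrite ?in_setX ?xX //= e.
    + by apply/orP; left; apply/orP; right; apply/imsetP; exists (x, y); rewrite ?in_setX ?xX //= e.
    by apply/orP; right; apply/imsetP; exists (x, y); rewrite ?in_setX ?xX //= e.
  have imN (f : gT * gT -> gT * gT * gT) : (#|f @: XX| <= N ^ 2)%N.
    by apply: leq_trans (leq_imset_card _ _) _; rewrite cardsX -mulnn leq_mul.
  apply: leq_trans (subset_leq_card sub) _.
  apply: leq_trans (leq_card_setU _ _) _; rewrite !mulSn mul0n addn0 addnA.
  apply: leq_add; last exact: imN.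
  by apply: leq_trans (leq_card_setU _ _) _; apply: leq_add; apply: imN.
(* Each [X :&: borel L] has square at most [4 N], and the sizes sum to at most [2 N] because a
   non-scalar element fixes at most two lines; so the cubes sum to at most [8 N^2]. *)
have cardL : (#|badL| <= 8 * N ^ 2)%N.
  have le L : (#|X :&: borel L| ^ 2 <= 4 * N)%N.
    have [a /setDP[aSL aL] aN] := XL L.
    apply: leq_trans (@card_borel_trace t (X :&: borel L) a L _ _ aSL aL) _.
    - exact: subsetIr.
    - by move=> x /setIP[/Xt].
    rewrite leq_mul2l /=; apply: leq_trans aN; apply: subset_leq_card.
    by rewrite mulgSS ?mulSg ?subsetIl.
  have sumL : (\sum_L #|X :&: borel L| <= 2 * N)%N.
    have -> : (\sum_L #|X :&: borel L| = \sum_(x in X) #|[set L | x \in borel L]|)%N.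
      transitivity (\sum_L \sum_(x in X) (x \in borel L : nat))%N.
        by apply: eq_bigr => L _; rewrite -sum1_card big_mkcond [RHS]big_mkcond; apply: eq_bigr => x _; rewrite in_setI; case: (x \in X); case: (x \in _).
      rewrite exchange_big; apply: eq_bigr => x _.
      by rewrite -sum1_card [RHS]big_mkcond; apply: eq_bigr => L _; rewrite inE; case: (x \in _).
    apply: (@leq_trans (\sum_(x in X) 2)%N).
      by apply: leq_sum => x xX; apply/card_borels/nsX.
    by rewrite sum_nat_const mulnC leq_mul.
  apply: (@leq_trans (\sum_L 4 * N * #|X :&: borel L|)%N); last first.
    rewrite -big_distrr /= (_ : 8 * N ^ 2 = 4 * N * (2 * N))%N ?leq_mul //.
    by rewrite -mulnn; ring.
  apply: (@leq_trans (\sum_L #|X :&: borel L| ^ 3)%N); last first.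
    by apply: leq_sum => L _; rewrite expnSr leq_mul.
  rewrite /badL; elim/big_rec2: _ => [|L m Y _ ih]; first by rewrite cards0.
  apply: leq_trans (leq_card_setU _ _) _.
  by rewrite !cardsX leq_add // mulnn -expnSr.
(* Three triples in one fibre would, by [good_fibre], put the first of them inside a single Borel
   subgroup, which [good] excludes. *)
have cardG : (#|good| <= 2 * N ^ 2)%N.
  pose f (u : gT * gT * gT) := ((u.1.1 * u.1.2^-1)%g, (u.2 * u.1.2^-1)%g).
  have -> : (N ^ 2 = N * N)%N by rewrite mulnn.
  apply: (@leq_trans (2 * #|setX (X * X^-1)%g (X * X^-1)%g|)%N); last first.
    by rewrite cardsX leq_mul // leq_mul.
  apply: (card_fibres (f := f)) => [[[x y] z]|[g1 g3] _].
    case/setDP; rewrite !in_setX /= => /andP[/andP[xX yX] zX] _.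
    by rewrite !mem_mulg ?mem_invg ?invgK.
  rewrite leqNgt; apply/negP => /card_gt2P[[[u1 u] u3] [[[v1 v] v3] [[[w1 w] w3] [[]]]]].
  have mid x y z : (x, y, z) \in [set u in good | f u == (g1, g3)] ->
     [/\ x \in X, y \in X & z \in X] /\ [/\ x = (g1 * y)%g & z = (g3 * y)%g].
    case/setIdP=> /setDP[]; rewrite !in_setX => /andP[/andP[/= xX yX] zX] _ /eqP[<- <-].
    by rewrite !mulgKV.
  move=> uD vD wD.
  have [[u1X uX u3X] [e1 e3]] := mid _ _ _ uD.
  have [[v1X vX v3X] [f1 f3]] := mid _ _ _ vD.
  have [[w1X wX w3X] [h1 h3]] := mid _ _ _ wD.
  subst u1 u3 v1 v3 w1 w3 => -[uv vw wu].
  case/setIdP: uD => /setDP[uuD]; rewrite in_setU negb_or => /andP[ub ue] _.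
  have [L [uL u1L u3L]] : exists L, [/\ u \in borel L, (g1 * u)%g \in borel L & (g3 * u)%g \in borel L].
    apply: (@good_fibre t g1 g3 u v w) => //.
    - have XS x : x \in X -> x \in SL by move/(subsetP XSL).
      have MS g : (g * u)%g \in X -> g \in SL by move=> /XS; rewrite groupMr // XS.
      move=> x; rewrite !in_cons in_nil orbF.
      case/or4P=> [/eqP->|/eqP->|/eqP->|/orP[/eqP->|/eqP->]]; first [exact: XS | exact: MS].
    - by move=> x; rewrite !in_cons in_nil orbF => /or3P[] /eqP ->; rewrite !Xt.
    - by apply: contra uv => /eqP ->.
    - by apply: contra vw => /eqP ->.
    - by apply: contra wu => /eqP ->.
    - by apply: contra ue => /eqP e; apply/setIdP; split; rewrite //= e mul1g eqxx.
    - by apply: contra ue => /eqP e; apply/setIdP; split; rewrite //= e mul1g eqxx orbT.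
    - by apply: contra ue => /eqP e; apply/setIdP; split; rewrite //= e eqxx !orbT.
  case/negP: ub; apply/bigcupP; exists L => //.
  by rewrite !in_setX !in_setI u1X uX u3X uL u1L u3L.
have -> : (#|X| ^ 3 = #|D|)%N by rewrite !cardsX mulnn -expnSr.
have sD : D \subset good :|: (badL :|: E) by by apply/subsetP=> u uD; rewrite in_setU in_setD uD andbT orNb.
apply: leq_trans (subset_leq_card sD) _.
apply: leq_trans (leq_card_setU _ _) _.
apply: leq_trans (leq_add cardG (leq_trans (leq_card_setU _ _) (leq_add cardL cardE))) _.
by rewrite -!mulnDl.
Qed.
End Lines.

(** * Escape from degenerate traces *)

Section Escape.
Variables (F : finFieldType) (gT : matrix_model F).
Local Notation SL := (SL gT).
Implicit Types (g h x y u v w : gT) (B S X Y : {set gT}) (L : option F).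
Hypothesis two_neq0 : 1 + 1 != 0 :> F.
Hypothesis three_neq0 : 1 + 1 + 1 != 0 :> F.

Definition generic g := (tr g != 0) && regular g.

(** Cayley-Hamilton in the form [g^2 = tr g * g - 1]. *)
Lemma trMM g h : g \in SL -> tr (g * g * h)%g = tr g * tr (g * h)%g - tr h.
Proof.
move=> /SL_det dg; apply: (eq_combr (k := - tr h) dg).
by rewrite /tr !entM; ring.
Qed.

Lemma tr_sqr g : g \in SL -> tr (g * g)%g = tr g ^+ 2 - (1 + 1).
Proof. by move=> gSL; have := trMM 1%g gSL; rewrite !mulg1 tr1 => ->; rewrite expr2. Qed.

(** Cayley-Hamilton after writing the product as [(u a) (a u^-1)^-1]. The trace differs from 2
    unless [a] satisfies a linear equation, which is what escape exploits. *)
Lemma unipotent_trace u a e : u \in SL -> a \in SL -> tr u = (1 + 1) * e -> e ^+ 2 = 1 ->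
  tr (u * u ^ a^-1)%g = (1 + 1) - (tr (u * a)%g - e * tr a) ^+ 2.
Proof.
move=> uSL aSL tu e2.
have -> : (u * u ^ a^-1 = (u * a) * (a * u^-1)^-1)%g by rewrite conjgE invMg !invgK !mulgA.
rewrite trMV ?groupM ?groupV // trMV // [tr (u * a * _)%g]trMC.
have -> : (a * u^-1 * (u * a) = a * a)%g by rewrite !mulgA mulgKV.
rewrite tr_sqr // tu [tr (a * u)%g]trMC.
by apply: (eq_combr (k := tr a ^+ 2) e2); ring.
Qed.

(** Since [6^2 - 2^2 = 2^5], traces 6 and -6 are generic once 2 and 3 are invertible. *)
Lemma generic_of_tr6 g e : e ^+ 2 = 1 -> tr g = (1 + 1) * (1 + 1 + 1) * e -> generic g.
Proof.
move=> e2 tg; have e0 : e != 0.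
  by apply: contra_eq_neq e2 => ->; rewrite expr0n eq_sym oner_eq0.
rewrite /generic /regular tg !mulf_neq0 //= -subr_eq0.
have -> : ((1 + 1) * (1 + 1 + 1) * e) ^+ 2 - (1 + 1) ^+ 2 = (1 + 1) ^+ 5 + ((1 + 1) * (1 + 1 + 1)) ^+ 2 * (e ^+ 2 - 1) by ring.
by rewrite e2 subrr mulr0 addr0 expf_neq0.
Qed.

Section Generating.
Variable A : {set gT}.
Hypothesis A_SL : A \subset SL.
Hypothesis A_gen : forall H : {group gT}, H \proper SL -> ~~ (A \subset H).
Hypothesis AV : (A^-1)%g = A.
Hypothesis A1 : 1%g \in A.

Lemma mem_expgD x y m n : x \in (A ^+ m)%g -> y \in (A ^+ n)%g -> (x * y)%g \in (A ^+ (m + n))%g.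
Proof. by rewrite expgD; apply: mem_mulg. Qed.

Lemma exps_SL n x : x \in (A ^+ n)%g -> x \in SL.
Proof.
elim: n x => [|n IH] x; first by rewrite expg0 => /set1P ->; rewrite group1.
by rewrite expgS => /mulsgP[a b /(subsetP A_SL) aSL /IH bSL ->]; apply: groupM.
Qed.

Lemma exps_leq x m n : x \in (A ^+ m)%g -> (m <= n)%N -> x \in (A ^+ n)%g.
Proof. by move=> xm mn; apply: subsetP xm; apply: expsg_subl. Qed.

Lemma not_in_borel L : exists2 a, a \in A & a \notin borel gT L.
Proof. exact/subsetPn/(A_gen (borel_proper gT L : borel_group gT L \proper SL)). Qed.

Lemma mem_memV a : a \in A -> (a^-1)%g \in A.
Proof. by move=> aA; rewrite -AV mem_invg invgK. Qed.

(** Take [v = a u a^-1] with [a] moving the eigenline of [u], so that [T = tr (u v)] is not 2. If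
    [T = 0], then [u^2 v^2] has trace -6; if [T = -2], then [u^2 v] has trace [- 6 e]; otherwise
    [u v] is generic. The longest word, [u^2 v^2], has length [4 k + 2]. *)
Lemma escape_unipotent u k : u \in (A ^+ k)%g -> ~~ is_scalar u ->
  tr u ^+ 2 = (1 + 1) ^+ 2 -> exists2 y, y \in (A ^+ (4 * k + 2))%g & generic y.
Proof.
move=> uk nu /eqP; rewrite eqf_sqr => tu; have uSL := exps_SL uk.
have [e e2 {}tu] : exists2 e : F, e ^+ 2 = 1 & tr u = (1 + 1) * e.
  by case/orP: tu => /eqP ->; [exists 1 | exists (-1)]; ring.
(* The equation [tr (u a) = e * tr a] says [tr ((u - e) a) = 0], where [u - e] is nilpotent, so it
   would put [a] in the Borel subgroup of the eigenline of [u]. *)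
have [a aA ta] : exists2 a, a \in A & tr (u * a)%g - e * tr a != 0.
  have [||L LP] := @nilpotent_line F gT (e00 u - e) (e01 u) (e10 u).
  - apply: contraR nu; rewrite /is_scalar !negb_or !negbK subr_eq0 => /and3P[/eqP z1 -> ->].
    by apply/eqP; apply: (eq_combr (k := -1) tu); rewrite /tr z1; ring.
  - have du := SL_det uSL; have u11 : e11 u = (1 + 1) * e - e00 u by rewrite -tu /tr; ring.
    apply: (eq_combr (k := -1) (etrans du (esym e2))); rewrite u11; ring.
  have [a aA aL] := not_in_borel L; exists a => //.
  apply: contra aL => /eqP h; apply: LP; first exact: subsetP aA.
  have u11 : e11 u = (1 + 1) * e - e00 u by rewrite -tu /tr; ring.
  by rewrite -h /tr !entM u11; ring.
have aSL := subsetP A_SL _ aA.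
pose v := (u ^ a^-1)%g; pose T := tr (u * v)%g.
have vE : v = (a * u * a^-1)%g by rewrite /v conjgE invgK mulgA.
have vSL : v \in SL by rewrite groupJ ?groupV.
have tv : tr v = tr u by rewrite trJ.
have T2 : T - (1 + 1) != 0.
  have -> : T - (1 + 1) = - (tr (u * a)%g - e * tr a) ^+ 2.
    by rewrite /T /v (unipotent_trace uSL aSL tu e2); ring.
  by rewrite oppr_eq0 expf_neq0.
have t3 : tr (u * u * v)%g = (1 + 1) * e * (T - 1) by rewrite trMM // -/T tv tu; ring.
have t4 : tr (u * u * (v * v))%g = (1 + 1) ^+ 2 * T - (1 + 1) * (1 + 1 + 1).
  rewrite trMM // [tr (u * _)%g]trMC trMM // [tr (v * u)%g]trMC -/T tr_sqr // tv tu.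
  by apply: (eq_combr (k := (1 + 1) ^+ 2 * (T - 1 - 1)) e2); ring.
have aAV : (a^-1)%g \in (A ^+ 1)%g by rewrite expg1 mem_memV.
have aA1 : a \in (A ^+ 1)%g by rewrite expg1.
have vk : v \in (A ^+ (1 + k + 1))%g by rewrite vE; apply: mem_expgD aAV; apply: mem_expgD.
have [T0|T0] := eqVneq T 0.
  exists (u * u * (v * v))%g; last first.
    by apply: (@generic_of_tr6 _ (-1)); [ring | rewrite t4 T0; ring].
  have -> : (v * v = a * (u * u) * a^-1)%g by rewrite vE !mulgA mulgKV.
  apply: (@exps_leq _ (k + k + (1 + (k + k) + 1))); last by clear; lia.
  apply: (mem_expgD (mem_expgD uk uk) (mem_expgD _ aAV)).
  exact: mem_expgD aA1 (mem_expgD uk uk).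
have [Tm|Tm] := eqVneq T (- (1 + 1)).
  exists (u * u * v)%g; last first.
    by apply: (@generic_of_tr6 _ (- e)); [rewrite sqrrN | rewrite t3 Tm; ring].
  apply: (@exps_leq _ (k + k + (1 + k + 1))); last by clear; lia.
  exact: mem_expgD (mem_expgD uk uk) vk.
exists (u * v)%g; last first.
  rewrite /generic -/T T0 /regular /= -/T -subr_eq0 subr_sqr mulf_neq0 //.
  by rewrite -[1 + 1]opprK subr_eq0.
by apply: (@exps_leq _ (k + (1 + k + 1))); [exact: mem_expgD uk vk | by clear; lia].
Qed.

(** Without generic or non-scalar trace 2 or -2 elements in [A ^+ 2], all its non-scalar elements
    have trace 0. Then every element of [A] sends a fixed non-scalar [g] to [g] or [g^-1] by
    conjugation, so [A] lies in the proper subgroup [N]. The exponent is [10 = 4 * 2 + 2]. *)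
Lemma escape : exists2 y, y \in (A ^+ 10)%g & generic y.
Proof.
have [u /andP[/andP[u2 nu] /eqP tu]|no_unip] := pickP (fun u => (u \in (A ^+ 2)%g) && ~~ is_scalar u && (tr u ^+ 2 == (1 + 1) ^+ 2)).
  exact: (@escape_unipotent u 2).
have [y /andP[y2 gy]|no_gen] := pickP (fun y => (y \in (A ^+ 2)%g) && generic y).
  by exists y => //; apply: exps_leq y2 _.
have tr0 x : x \in (A ^+ 2)%g -> ~~ is_scalar x -> tr x = 0.
  move=> x2 nx; have := no_gen x; rewrite x2 /= /generic /regular => /negbT.
  rewrite negb_and !negbK => /orP[/eqP //|tx].
  by have := no_unip x; rewrite x2 nx tx.
have [g gA gB] := not_in_borel None; have gSL := subsetP A_SL _ gA.
have g10 : e10 g != 0 by apply: contra gB; rewrite borelN gSL.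
have ng : ~~ is_scalar g by rewrite /is_scalar !negb_and g10 orbT.
have A2 x : x \in A -> x \in (A ^+ 2)%g.
  by move=> xA; apply: (@exps_leq _ 1); rewrite ?expg1.
have tg := tr0 _ (A2 _ gA) ng.
have gV11 : e11 g = - e00 g by apply: (eq_combr (k := 1) tg); rewrite /tr; ring.
have scalar_commute x y : is_scalar x -> commute x y.
  case/and3P=> /eqP h1 /eqP h2 /eqP h3; apply/commuteE.
  by rewrite h1 h2 h3 subrr !mul0r !mulr0.
pose N := ('N([set g; g^-1%g]) :&: SL)%G.
have NP : N \proper SL.
  apply/properP; split; first exact: subsetIr.
  have [|[h0 h1 h2 h3] mSL] := @mk_SL F gT 1 1 0 1; first ring.
  set m := mk _ _ _ _ _ in h0 h1 h2 h3 mSL; exists m => //; rewrite in_setI mSL andbT; apply/negP => /normP Ng.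
  have : (g ^ m)%g \in [set g; g^-1%g] by rewrite -Ng memJ_conjg set21.
  case/set2P => [/conjg_fixP/commgP gm|gm].
    have := congr1 e00 (gm : (_ * _ = _ * _)%g); rewrite !entM h0 h1 h2 => e.
    by case/eqP: g10; apply: (eq_combr (k := -1) e); ring.
  have := congr1 e10 (conjgC g m).
  rewrite gm !entM !entV // h0 h2 h3 => e.
  case/eqP: g10; apply: (eq_divr two_neq0).
  by apply: (eq_combr (k := 1) e); ring.
case/negP: (A_gen NP); apply/subsetP => x xA.
have xSL := subsetP A_SL _ xA.
suff gx : (g ^ x)%g \in [set g; g^-1%g].
  rewrite in_setI xSL andbT inE; apply/subsetP => _ /imsetP[y /set2P[] -> ->] //.
  by rewrite conjVg; case/set2P: gx => ->; rewrite ?invgK ?set21 ?set22.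
have comm_in : commute g x -> (g ^ x)%g \in [set g; g^-1%g].
  by move/commgP/conjg_fixP=> ->; rewrite set21.
have [sx|nx] := boolP (is_scalar x); first by apply/comm_in/commute_sym/scalar_commute.
have tx := tr0 _ (A2 _ xA) nx.
have gx2 : (g * x)%g \in (A ^+ 2)%g by rewrite expgS expg1 mem_mulg.
have [sgx|ngx] := boolP (is_scalar (g * x)%g).
  apply: comm_in; have e := scalar_commute _ g sgx.
  by apply: (mulgI g); rewrite /commute -mulgA in e *; rewrite e.
have tgx := tr0 _ gx2 ngx.
have x11 : e11 x = - e00 x by apply: (eq_combr (k := 1) tx); rewrite /tr; ring.
(* A trace 0 element of [SL] has its negative as inverse; with [x] and [g x] this gives
   [- g x = (g x)^-1 = x^-1 g^-1 = - x g^-1]. *)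
suff gxE : (g * x = x * g^-1)%g by rewrite conjgE gxE mulKg set22.
have e : e00 g * e00 x + e01 g * e10 x + (e10 g * e01 x + e00 g * e00 x) = 0.
  by rewrite -tgx /tr !entM gV11 x11; ring.
apply: ent_inj; rewrite !entM !entV // gV11 x11; split.
- by apply: (eq_combr (k := 1) e); ring.
- by ring.
- by ring.
- by apply: (eq_combr (k := 1) e); ring.
Qed.
End Generating.
End Escape.

(** * The pivot argument *)

Section Pivot.
Variables (F : finFieldType) (gT : matrix_model F).
Local Notation SL := (SL gT).
Implicit Types (g h x y u v w : gT) (B S X Y : {set gT}) (L : option F).

Lemma card_SL_ge : (#|F| ^ 2 * #|F|.-1 <= #|SL|)%N.
Proof.
pose D := setX (setX [set~ (0 : F)] [set: F]) [set: F].
pose f (u : F * F * F) := mk gT u.1.1 u.1.2 u.2 ((1 + u.1.2 * u.2) / u.1.1).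
have fE (u : F * F * F) : u \in D -> [/\ e00 (f u) = u.1.1, e01 (f u) = u.1.2 & e10 (f u) = u.2] /\ f u \in SL.
  case: u => -[a b] c; rewrite !in_setX !in_setC1 => /andP[/andP[/= a0 _] _].
  by have [|[h0 h1 h2 _] fSL] := @mk_SL _ gT a b c ((1 + b * c) / a); first field.
have <- : #|f @: D| = (#|F| ^ 2 * #|F|.-1)%N.
  rewrite card_in_imset; first by rewrite !cardsX cardsC1 !cardsT -mulnA mulnC mulnn.
  move=> [[a b] c] [[a' b'] c'] /fE[[/= h0 h1 h2] _] /fE[[/= k0 k1 k2] _] e.
  by rewrite e in h0 h1 h2; rewrite -h0 -h1 -h2 k0 k1 k2.
by apply/subset_leq_card/subsetP => _ /imsetP[u /fE[_ ?] ->].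
Qed.

Lemma card_SL_le : (#|SL| <= #|F| ^ 3)%N.
Proof.
(* The missing entry follows from [det = 1]: it is [e11] when [e00] is nonzero, and [e10] when
   [e00 = 0], since then [e01] is nonzero. *)
pose f g := (e00 g, e01 g, if e00 g == 0 then e11 g else e10 g).
have <- : #|[set: F * F * F]| = (#|F| ^ 3)%N by rewrite cardsT !card_prod mulnn -expnSr.
rewrite -(card_in_imset (f := f)) ?subset_leq_card ?subsetT // => g h /SL_det dg /SL_det dh.
case=> h0 h1; rewrite h0; case: eqVneq => [a0|a0] h2.
  have b0 : e01 h != 0.
    apply/eqP => b0; move/eqP: dh; rewrite a0 b0 !mul0r subrr eq_sym.
    by rewrite oner_eq0.
  apply: ent_inj; split=> //; apply: (eq_divr b0).
  by rewrite h0 h1 h2 a0 in dg dh *; apply: (eq_combr (k := -1) (etrans dg (esym dh))); rewrite ?a0; ring.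
apply: ent_inj; split=> //; apply: (eq_divr a0).
by rewrite h0 h1 h2 in dg *; apply: (eq_combr (k := 1) (etrans dg (esym dh))); ring.
Qed.

Lemma card_scalars : (#|[set x in SL | is_scalar x]| <= 2)%N.
Proof.
have e2 : leq #|[set (1 : F); -1 : F]| 2 by rewrite cards2; case: (_ == _).
apply: leq_trans e2; rewrite -[X in (_ <= X)%N]mul1n.
apply: (card_fibres (f := e00)) => [x /setIdP[xSL]|z _].
  case/(scalar_SL xSL)/orP => [/eqP->|/andP[_ /eqP->]]; last exact: set22.
  by rewrite ent1 set21.
apply/card_le1_eqP => x y /setIdP[/setIdP[_ sx] /eqP ex] /setIdP[/setIdP[_ sy] /eqP ey].
case/and3P: sx => /eqP x1 /eqP x2 /eqP x3; case/and3P: sy => /eqP y1 /eqP y2 /eqP y3.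
by apply: ent_inj; rewrite x1 x2 y1 y2 -x3 -y3 ex ey.
Qed.

Hypothesis two_neq0 : 1 + 1 != 0 :> F.
Hypothesis three_neq0 : 1 + 1 + 1 != 0 :> F.

Lemma card_commuting_trace g (t : F) : g \in SL -> ~~ is_scalar g ->
  (#|[set x in SL | [&& x \in 'C[g]%g, regular x & tr x == t]]| <= 2)%N.
Proof.
move=> gSL ng; set D := [set x in _ | _].
have [->|[h hD]] := set_0Vmem D; first by rewrite cards0.
have DP x : x \in D -> [/\ x \in SL, commute g x, regular x & tr x = t].
  by case/setIdP=> xSL /and3P[/cent1P/commute_sym cx rx /eqP tx].
have [hSL ch rh th] := DP h hD.
have sub : D \subset [set h; h^-1%g].
  apply/subsetP => x /DP[xSL cx rx tx]; apply/set2P.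
  by apply: (commuting_same_trace two_neq0 ng) => //; rewrite tx th.
by apply: leq_trans (subset_leq_card sub) _; rewrite cards2; case: (_ == _).
Qed.

(** Such elements are the two scalars or regular of trace 0, again at most two. This 4 is the
    threshold of the pivot step. *)
Lemma card_not_generic g : g \in SL -> regular g ->
  (#|[set x in SL | (x \in 'C[g]%g) && ~~ generic x]| <= 4)%N.
Proof.
move=> gSL rg; have ng := regular_nscalar gSL rg.
set D := [set x in _ | _].
have sub : D \subset [set x in SL | is_scalar x] :|:
    [set x in SL | [&& x \in 'C[g]%g, regular x & tr x == 0]].
  apply/subsetP => x /setIdP[xSL /andP[cx ngx]]; apply/setUP.
  have [sx|nsx] := boolP (is_scalar x); [left; exact/setIdP | right; apply/setIdP; split=> //].
  have rx : regular x by apply: (regular_commute gSL xSL rg _ nsx); apply/commute_sym/cent1P.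
  by move: ngx; rewrite /generic rx andbT negbK cx => ->.
apply: leq_trans (subset_leq_card sub) _; apply: leq_trans (leq_card_setU _ _) _.
by apply: (@leq_add _ _ 2 2); [exact: card_scalars | exact: card_commuting_trace].
Qed.

(** Each trace value occurs at most twice in the centraliser; traces 2 and -2 occur only for
    scalars, as non-scalar elements commuting with [g] are regular. *)
Lemma card_cent1 g : g \in SL -> regular g -> (#|'C_SL[g]%g| <= 2 * #|F|)%N.
Proof.
move=> gSL rg; have ng := regular_nscalar gSL rg.
have -> : #|F| = #|[set: F]| by rewrite cardsT.
apply: (card_fibres (f := @tr F gT)) => // t _.
have [treg|tnreg] := boolP (t ^+ 2 != (1 + 1) ^+ 2).
  apply: leq_trans (card_commuting_trace t gSL ng).
  apply/subset_leq_card/subsetP => x /setIdP[/setIP[xSL cx] tx].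
  by apply/setIdP; split => //; rewrite cx /regular (eqP tx) treg eqxx.
apply: leq_trans card_scalars.
apply/subset_leq_card/subsetP => x /setIdP[/setIP[xSL cx] tx].
apply/setIdP; split=> //; apply: contraR tnreg => nsx.
have: regular x by apply: (regular_commute gSL xSL rg _ nsx); apply/commute_sym/cent1P.
by rewrite /regular (eqP tx).
Qed.

Section Generating.
Variable A : {set gT}.
Hypothesis A_SL : A \subset SL.
Hypothesis A_gen : forall H : {group gT}, H \proper SL -> ~~ (A \subset H).
Hypothesis AV : (A^-1)%g = A.
Hypothesis A1 : 1%g \in A.
Let N := #|(A ^+ 36)%g|.

(** The lower bound [#|A| / N^(2/3)] of orbit-stabiliser, with its constant, cubed so as to stay in
    the integers. *)
Definition big_centraliser y := (#|A| ^ 3 <= #|(A ^+ 2 :&: 'C[y])%g| ^ 3 * (13 * N ^ 2))%N.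

(** The conjugates [y ^ a] lie in [A ^+ 12], as [12 = 1 + 10 + 1]. The product sets needed by
    [larsen_pink_trace] lie in [A ^+ 24] and [A ^+ 25], hence in [A ^+ 36]. *)
Lemma big_centraliser_generic y : y \in (A ^+ 10)%g -> generic y -> big_centraliser y.
Proof.
move=> y10 /andP[ty0 ry]; have ySL := exps_SL A_SL y10.
pose X := [set x in (A ^+ 12)%g | tr x == tr y].
have XA : X \subset (A ^+ 12)%g by apply/subsetP => x /setIdP[].
have le n m : (n <= m)%N -> (#|(A ^+ n)%g| <= #|(A ^+ m)%g|)%N.
  by move=> nm; apply/subset_leq_card/expsg_subl.
have orb : (#|A| <= #|(A ^+ 2 :&: 'C[y])%g| * #|X|)%N.
  have -> : (A ^+ 2 = A * A^-1)%g by rewrite AV expgS expg1.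
  apply: leq_card_orbit => a aA; apply/setIdP; rewrite trJ; split=> //.
  rewrite conjgE mulgA (_ : 12 = 1 + 10 + 1)%N //.
  by rewrite !(mem_expgD, expg1) // mem_memV.
apply: (@leq_trans ((#|(A ^+ 2 :&: 'C[y])%g| * #|X|) ^ 3)%N); first by rewrite leq_exp2r.
rewrite expnMn leq_mul //.
apply: (@larsen_pink_trace _ gT (tr y) X N two_neq0 ty0 ry).
- by apply/subsetP => x /(subsetP XA) /(exps_SL A_SL).
- by move=> x /setIdP[_ /eqP].
- apply: leq_trans (le 24 36 isT); apply: subset_leq_card.
  have -> : (A ^+ 24 = A ^+ 12 * (A ^+ 12)^-1)%g by rewrite invsg_exp // -expgD.
  by rewrite mulgSS // invSg.
move=> L; have [a aA aL] := not_in_borel A_gen L.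
exists a; first by apply/setDP; rewrite (subsetP A_SL).
apply: leq_trans (le 25 36 isT); apply: subset_leq_card.
have -> : (A ^+ 25 = A ^+ 12 * A * A ^+ 12)%g by rewrite -expgSr -expgD.
by rewrite mulgSS // mulgSS // sub1set.
Qed.

(** With [64 = 4 ^ 3], a big centraliser meets [A ^+ 2] in more than four elements, hence more than
    its non-generic ones. *)
Hypothesis large_A : (13 * 64 * N ^ 2 < #|A| ^ 3)%N.

(** A generic [y] in [A ^+ 4] commutes with [h ^ a]. As 4 is at most 10, [y] has a big centraliser,
    and everything commuting with [y] commutes with [h ^ a]. *)
Lemma big_centraliserJ h a : h \in SL -> generic h -> big_centraliser h -> a \in A ->
  big_centraliser (h ^ a)%g.
Proof.
move=> hSL /andP[th rh] bh aA; have aSL := subsetP A_SL _ aA.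
pose K := ((A ^+ 2 :&: 'C[h]) :^ a)%g.
have rha : regular (h ^ a)%g by rewrite /regular trJ.
have haSL : (h ^ a)%g \in SL by rewrite groupJ.
have cardK : (4 < #|K|)%N.
  rewrite cardJg ltnNge; apply/negP => le4; move: large_A; rewrite ltnNge => /negP[].
  apply: leq_trans bh _; rewrite mulnAC -[(13 * _ ^ 2 * 64)%N]mulnC leq_mul //.
  by rewrite -[64%N]/(4 ^ 3)%N leq_exp2r.
have /subsetPn[y yK yn] : ~~ (K \subset [set x in SL | (x \in 'C[(h ^ a)%g]%g) && ~~ generic x]).
  apply: contraL cardK => /subset_leq_card le; rewrite -leqNgt.
  exact: leq_trans le (card_not_generic haSL rha).
have [y4 cy] : y \in (A ^+ 4)%g /\ y \in 'C[(h ^ a)%g]%g.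
  case/imsetP: yK => x /setIP[x2 cx] ->; split; last first.
    by rewrite -conjg_set1 normJ memJ_conjg.
  rewrite conjgE mulgA (_ : 4 = 1 + 2 + 1)%N //.
  by rewrite !(mem_expgD, expg1) // mem_memV.
have ySL := exps_SL A_SL y4.
have gy : generic y by apply: contraR yn => ngy; apply/setIdP; rewrite cy.
have ry : regular y by case/andP: gy.
have by_ : big_centraliser y by apply: big_centraliser_generic => //; apply: exps_leq y4 _.
apply: leq_trans by_ _; rewrite leq_mul // leq_exp2r //; apply: subset_leq_card.
apply/subsetP => x /setIP[x2 /cent1P cx]; rewrite in_setI x2; apply/cent1P.
apply: (commute_trans (regular_nscalar ySL ry) cx).
exact/cent1P.
Qed.

Lemma gen_SL : <<A>>%g = SL.
Proof.
apply/eqP; rewrite eqEproper gen_subG A_SL /=; apply/negP => lt.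
by case/negP: (A_gen (lt : <<A>>%G \proper SL)); apply: subset_gen.
Qed.

Lemma conjugates_big_centraliser : exists y,
  [/\ y \in SL, generic y & {in SL, forall x, big_centraliser (y ^ x)%g}].
Proof.
have [y y10 gy] := escape two_neq0 three_neq0 A_SL A_gen AV A1.
have ySL := exps_SL A_SL y10.
exists y; split=> // x; rewrite -gen_SL; have [n ->] := gen_expgs A.
rewrite (setUidPr _) ?sub1set //; elim: n x => [|n IH] x.
  by rewrite expg0 => /set1P ->; rewrite conjg1; apply: big_centraliser_generic.
rewrite expgSr => xn; have [b a bn aA ->] := mulsgP xn; rewrite conjgM.
have bSL := exps_SL A_SL bn.
apply: big_centraliserJ => //; last exact: IH.
  by rewrite groupJ.
by rewrite /generic /regular trJ.
Qed.

(** Counting pairs of a conjugate [h] of [y] and a non-scalar [z] in [A ^+ 2] commuting with it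
    gives [q^2 m <= 16 N], where [m] bounds all the centralisers from below. Cubing and inserting
    the bound on [#|A| ^ 3] yields the claim. *)
Lemma growth_of_large : (#|F| ^ 6 * #|A| ^ 3 <= 16 ^ 3 * 13 * N ^ 5)%N.
Proof.
have [y [ySL /andP[ty ry] bigy]] := conjugates_big_centraliser.
set q := #|F|; pose Cl := (y ^: SL)%g.
have q2 : (1 < q)%N by exact: card_finNzRing_gt1.
have ClP h : h \in Cl -> [/\ h \in SL, tr h = tr y, regular h & big_centraliser h].
  by case/imsetP => x xSL ->; rewrite groupJ // /regular trJ; split=> //; apply: bigy.
have cardCl : (q ^ 2 <= 4 * #|Cl|)%N.
  have := card_SL_ge; rewrite -(Lagrange (subsetIl SL 'C[y]%g)) index_cent1.
  have := card_cent1 ySL ry; rewrite -/q -/Cl => le1 le2.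
  have le3 : (q ^ 2 * q.-1 <= 2 * q * #|Cl|)%N by apply: leq_trans le2 _; rewrite leq_mul.
  clearbody q; clear -le3 q2; move: #|Cl| le3 => c le3.
  have: (q * (q * q.-1) <= q * (2 * c))%N by move: le3; rewrite -mulnn; lia.
  rewrite leq_pmul2l ?(ltnW q2) // => le4.
  have : (q <= 2 * q.-1)%N by lia.
  by move=> le5; rewrite -mulnn; nia.
(* The least such [m] is an integer lower bound for [A ^+ 2 :&: 'C[h]] valid for all conjugates [h]
   at once. *)
have exm : exists m, (#|A| ^ 3 <= m ^ 3 * (13 * N ^ 2))%N.
  by exists #|(A ^+ 2 :&: 'C[y])%g|; have := bigy 1%g (group1 _); rewrite conjg1.
case: (ex_minnP exm) => m Pm minm.
have m4 : (4 < m)%N.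
  rewrite ltnNge; apply/negP => le4; move: large_A; rewrite ltnNge => /negP[].
  apply: leq_trans Pm _; rewrite mulnAC -[(13 * _ ^ 2 * 64)%N]mulnC leq_mul //.
  by rewrite -[64%N]/(4 ^ 3)%N leq_exp2r.
pose A2 := [set z in (A ^+ 2)%g | ~~ is_scalar z].
have A2SL z : z \in A2 -> z \in SL by case/setIdP=> /(exps_SL A_SL).
have low h : h \in Cl -> (m - 2 <= #|[set z in A2 | z \in 'C[h]%g]|)%N.
  case/ClP=> hSL _ _ /minm; rewrite leq_subLR => /leq_trans-> //.
  apply: leq_trans (leq_add card_scalars (leqnn _)).
  apply: leq_trans (leq_card_setU _ _); apply/subset_leq_card/subsetP => z /setIP[z2 cz].
  apply/setUP; have [sz|nsz] := boolP (is_scalar z); [left | right]; apply/setIdP.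
    by rewrite (exps_SL A_SL z2).
  by split=> //; apply/setIdP.
have up z : z \in A2 -> (#|[set h in Cl | z \in 'C[h]%g]| <= 2)%N.
  move=> zA2; have nz : ~~ is_scalar z by case/setIdP: zA2.
  apply: leq_trans (card_commuting_trace (tr y) (A2SL _ zA2) nz).
  apply/subset_leq_card/subsetP => h /setIdP[/ClP[hSL th rh _] cz].
  by apply/setIdP; rewrite hSL cent1C cz rh th eqxx.
have dc : (#|Cl| * (m - 2) <= 2 * N)%N.
  rewrite -sum_nat_const.
  apply: (@leq_trans (\sum_(h in Cl) #|[set z in A2 | z \in 'C[h]%g]|)%N); first exact: leq_sum.
  rewrite double_count; apply: (@leq_trans (\sum_(z in A2) 2)%N); first exact: leq_sum.
  rewrite sum_nat_const mulnC leq_mul //; apply: subset_leq_card.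
  by apply: subset_trans (expsg_subl A1 (isT : (2 <= 36)%N)); apply/subsetP => z /setIdP[].
have q2m : (q ^ 2 * m <= 16 * N)%N.
  have le2 : (m <= 2 * (m - 2))%N by lia.
  apply: (@leq_trans (4 * #|Cl| * (2 * (m - 2)))%N); first exact: leq_mul.
  by rewrite mulnACA -[16%N]/(4 * 2 * 2)%N -[X in (_ <= X)%N]mulnA leq_mul.
apply: (@leq_trans (q ^ 6 * (m ^ 3 * (13 * N ^ 2)))%N); first by rewrite leq_mul.
rewrite mulnA [(q ^ 6)%N](expnM q 2 3) -expnMn.
apply: (@leq_trans ((16 * N) ^ 3 * (13 * N ^ 2))%N); first by rewrite leq_mul // leq_exp2r.
by rewrite expnMn mulnACA -expnD.
Qed.
End Generating.

Lemma growth_alternative (A : {set gT}) : A \subset SL ->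
  (forall H : {group gT}, H \proper SL -> ~~ (A \subset H)) ->
  (A^-1)%g = A -> 1%g \in A ->
  (#|A| ^ 3 <= 13 * 64 * #|(A ^+ 36)%g| ^ 2)%N \/
  (#|F| ^ 6 * #|A| ^ 3 <= 16 ^ 3 * 13 * #|(A ^+ 36)%g| ^ 5)%N.
Proof.
move=> ASL Agen AV A1; case: leqP => [|lt]; first by left.
by right; apply: growth_of_large.
Qed.
End Pivot.

(** * Point-line incidences *)

Section Incidences.
Variable F : finFieldType.
Implicit Types (P : {set F * F}).
Local Notation q := #|F|.

(** One pair is a line given by slope and intercept, the other a point. The relation is self-dual,
    so either pair may be read as the line. *)
Local Definition on_line (v p : F * F) := v.1 * p.1 + v.2 == p.2.
Local Definition incidences P (p : F * F) := #|[set v in P | on_line v p]|.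

Lemma sum_incidences P : (\sum_p incidences P p = q * #|P|)%N.
Proof.
rewrite (double_count predT (mem P)) mulnC -sum_nat_const; apply: eq_bigr => v _.
rewrite -[RHS]cardsT -(card_imset _ (f := fun m => (m, v.1 * m + v.2))); last by move=> m m' [].
apply: eq_card => -[m c]; rewrite inE /on_line /=.
by apply/eqP/imsetP => [<-|[m' _ [-> ->]] //]; exists m.
Qed.

Lemma card_two_lines (v w : F * F) : v != w ->
  (#|[set p | on_line v p & on_line w p]| <= 1)%N.
Proof.
move=> vw; apply/card_le1_eqP => -[m c] [m' c']; rewrite !inE /on_line /=.
move=> /andP[/eqP h1 /eqP h2] /andP[/eqP h1' /eqP h2'].
have [e|ne] := eqVneq v.1 w.1.
  case/eqP: vw; rewrite [v]surjective_pairing [w]surjective_pairing e.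
  by congr (_, _); apply: (addrI (v.1 * m)); rewrite h1 -h2 e.
have mm : m = m'.
  apply: (@eq_divr _ (v.1 - w.1)); first by rewrite subr_eq0.
  have e1 := etrans h1 (esym h2); have e2 := etrans h1' (esym h2').
  apply: (eq_combr (k := 1) (congr2 (fun a b => a - b) e1 e2)); ring.
by rewrite -h1 -h1' mm.
Qed.

(** Expand the square: a pair [v = w] contributes [q], and a pair of distinct elements at most 1. *)
Lemma sum_sqr_incidences P : (\sum_p incidences P p ^ 2 <= #|P| * (q + #|P|))%N.
Proof.
have sqrE p : (incidences P p ^ 2 = \sum_(v in P) \sum_(w in P) (on_line v p && on_line w p))%N.
  have E : (incidences P p = \sum_(v in P) on_line v p)%N.
    rewrite /incidences -sum1_card (eq_bigl (fun v => (v \in P) && on_line v p)).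
      by rewrite big_mkcondr; apply: eq_bigr => v _; case: on_line.
    by move=> v; rewrite inE.
  rewrite -mulnn E big_distrl; apply: eq_bigr => v _; rewrite big_distrr.
  by apply: eq_bigr => w _; rewrite -mulnb.
rewrite (eq_bigr _ (fun p _ => sqrE p)) exchange_big -sum_nat_const.
apply: leq_sum => v vP; rewrite exchange_big (bigD1 v) //=.
have cardE (w : F * F) : (\sum_p (on_line v p && on_line w p) = #|[set p | on_line v p & on_line w p]|)%N.
  rewrite -sum1_card [RHS]big_mkcond; apply: eq_bigr => p _; rewrite inE.
  by case: (_ && _).
apply: leq_add.
  rewrite cardE -cardsT -(card_imset _ (f := fun m => (m, v.1 * m + v.2))); last by move=> m m' [].
  apply/subset_leq_card/subsetP => -[m c]; rewrite inE /on_line andbb /= => /eqP <-.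
  by apply/imsetP; exists m.
rewrite -sum1_card [X in (_ <= X)%N](bigD1 v) //=; apply: leq_trans (leq_addl _ _).
by apply: leq_sum => w /andP[_ wv]; rewrite cardE card_two_lines // eq_sym.
Qed.

(** Second moment: the mean of [incidences P p] is [n / q]. Summing [(q * incidences P p - n)^2]
    over all [p], each missed [p] contributes [n^2], while the total is at most [n q^3]. *)
Lemma card_missed_lines P : (#|[set p | incidences P p == 0]| * #|P| <= q ^ 3)%N.
Proof.
set Z := [set p | _]; set n := #|P|.
have [->|n0] := posnP n; first by rewrite muln0.
have term p : (2 * (q * n * incidences P p) + (p \in Z) * n ^ 2 <=
    q ^ 2 * incidences P p ^ 2 + n ^ 2)%N.
  rewrite inE; case: eqP => [->|_]; first by rewrite !muln0 mul1n leq_addl.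
  rewrite mul0n addn0 -expnMn mulnAC; exact: nat_Cauchy.
have : (\sum_p (2 * (q * n * incidences P p) + (p \in Z) * n ^ 2) <=
    \sum_(p : F * F) (q ^ 2 * incidences P p ^ 2 + n ^ 2))%N by apply: leq_sum => p _.
have -> : (\sum_p (2 * (q * n * incidences P p) + (p \in Z) * n ^ 2) = 2 * (q * n * (q * n)) + #|Z| * n ^ 2)%N.
  rewrite big_split /=; congr (_ + _)%N.
    by rewrite -big_distrr -big_distrr /= sum_incidences.
  rewrite -big_distrl /=; congr (_ * _)%N.
  by rewrite -sum1_card [RHS]big_mkcond; apply: eq_bigr => p _; case: (_ \in _).
have -> : (\sum_(p : F * F) (q ^ 2 * incidences P p ^ 2 + n ^ 2) = q ^ 2 * (\sum_p incidences P p ^ 2) + q * q * n ^ 2)%N.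
  by rewrite big_split /= -big_distrr sum_nat_const card_prod.
move=> le; have {}le := leq_trans le (leq_add (leq_mul (leqnn (q ^ 2)) (sum_sqr_incidences P)) (leqnn _)).
rewrite -(leq_pmul2l n0).
have e1 : (n * (#|Z| * n) = #|Z| * n ^ 2)%N by ring.
have e2 : (q ^ 2 * (n * (q + n)) + q * q * n ^ 2 = 2 * (q * n * (q * n)) + n * q ^ 3)%N by ring.
by rewrite e1; rewrite e2 leq_add2l in le.
Qed.

(** Of the [#|X| ^ 2] lines [(x1, z - x3)], one meets the point set [setX Q X], which reads
    [s * x1 + x2 = z - x3]. *)
Lemma sum_product_covers (X Q : {set F}) (z : F) : (q ^ 3 < #|X| ^ 3 * #|Q|)%N ->
  exists s x1 x2 x3, [/\ s \in Q, x1 \in X, x2 \in X & x3 \in X] /\ z = s * x1 + x2 + x3.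
Proof.
move=> big; pose P := setX Q X.
pose L := [set (u.1, z - u.2) | u in setX X X].
have cardL : #|L| = (#|X| ^ 2)%N.
  by rewrite card_imset ?cardsX ?mulnn // => -[a b] [c d] [-> /addrI/oppr_inj ->].
have /subsetPn[_ /imsetP[[x1 x3] /setXP[/= x1X x3X] ->]] : ~~ (L \subset [set p | incidences P p == 0]).
  apply: contraL big => /subset_leq_card le; rewrite -leqNgt.
  apply: leq_trans (card_missed_lines P); rewrite -mulnn in cardL.
  rewrite expnSr -mulnA; apply: leq_mul; first by rewrite -mulnn -cardL.
  by rewrite cardsX mulnC.
rewrite inE cards_eq0 => /set0Pn[[s x2]]; rewrite inE => /andP[/setXP[/= sQ x2X] /eqP /= e].
exists s, x1, x2, x3; split=> //.
by apply: (eq_combr (k := -1) e); ring.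
Qed.
End Incidences.

(** * Very large sets *)

Section LargeSets.
Variables (F : finFieldType) (gT : matrix_model F).
Local Notation SL := (SL gT).
Local Notation q := #|F|.
Implicit Types (g h : gT) (A B : {set gT}) (x y z s : F).

Definition unip x : gT := mk gT 1 x 0 1.
Definition lunip x : gT := mk gT 1 0 x 1.
Definition diag x : gT := mk gT x 0 0 x^-1.

Lemma unipP x :
  [/\ e00 (unip x) = 1, e01 (unip x) = x, e10 (unip x) = 0 & e11 (unip x) = 1] /\ unip x \in SL.
Proof. by apply: mk_SL; ring. Qed.

Lemma lunipP x :
  [/\ e00 (lunip x) = 1, e01 (lunip x) = 0, e10 (lunip x) = x & e11 (lunip x) = 1] /\ lunip x \in SL.
Proof. by apply: mk_SL; ring. Qed.

Lemma diagP x : x != 0 ->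
  [/\ e00 (diag x) = x, e01 (diag x) = 0, e10 (diag x) = 0 & e11 (diag x) = x^-1] /\ diag x \in SL.
Proof. by move=> x0; apply: mk_SL; field. Qed.

Lemma unipD x y : unip (x + y) = (unip x * unip y)%g.
Proof.
have [[a1 a2 a3 a4] _] := unipP x; have [[b1 b2 b3 b4] _] := unipP y.
have [[c1 c2 c3 c4] _] := unipP (x + y).
by apply: ent_inj; rewrite !entM a1 a2 a3 a4 b1 b2 b3 b4 c1 c2 c3 c4; split; ring.
Qed.

Lemma diagM x y : x != 0 -> y != 0 -> diag (x * y) = (diag x * diag y)%g.
Proof.
move=> x0 y0; have xy0 := mulf_neq0 x0 y0.
have [[a1 a2 a3 a4] _] := diagP x0; have [[b1 b2 b3 b4] _] := diagP y0.
have [[c1 c2 c3 c4] _] := diagP xy0.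
apply: ent_inj; rewrite !entM a1 a2 a3 a4 b1 b2 b3 b4 c1 c2 c3 c4.
by split; first [by rewrite invfM; ring | by ring].
Qed.

Lemma unip0 : unip 0 = 1%g.
Proof. by have [[a1 a2 a3 a4] _] := unipP 0; apply: ent_inj; rewrite a1 a2 a3 a4 !ent1. Qed.

Lemma diag1 : diag 1 = 1%g.
Proof.
have [[a1 a2 a3 a4] _] := diagP (oner_neq0 F).
by apply: ent_inj; rewrite a1 a2 a3 a4 !ent1 invr1.
Qed.

Definition unipotents : {set gT} := [set unip x | x in [set: F]].
Definition torus : {set gT} := [set diag x | x in [set~ 0]].

Lemma unipotents_group_set : group_set unipotents.
Proof.
apply/group_setP; split=> [|_ _ /imsetP[x _ ->] /imsetP[y _ ->]].
  by apply/imsetP; exists 0; rewrite ?unip0.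
by apply/imsetP; exists (x + y); rewrite ?unipD.
Qed.

Lemma torus_group_set : group_set torus.
Proof.
apply/group_setP; split=> [|_ _ /imsetP[x + ->] /imsetP[y + ->]].
  by apply/imsetP; exists 1; rewrite ?diag1 // in_setC1 oner_neq0.
rewrite !in_setC1 => x0 y0.
by apply/imsetP; exists (x * y); rewrite ?diagM // in_setC1 mulf_neq0.
Qed.

Canonical unipotents_group := Group unipotents_group_set.
Canonical torus_group := Group torus_group_set.

Lemma unipotents_SL : unipotents \subset SL.
Proof. by apply/subsetP => _ /imsetP[x _ ->]; have [] := unipP x. Qed.

Lemma torus_SL : torus \subset SL.
Proof. by apply/subsetP => _ /imsetP[x + ->]; rewrite in_setC1 => /diagP[]. Qed.

Lemma card_unipotents : #|unipotents| = q.
Proof.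
rewrite card_imset ?cardsT // => x y e.
by have [[_ a2 _ _] _] := unipP x; have [[_ b2 _ _] _] := unipP y; rewrite -a2 -b2 e.
Qed.

Lemma card_torus : #|torus| = q.-1.
Proof.
rewrite card_in_imset ?cardsC1 // => x y; rewrite !in_setC1 => x0 y0 e.
by have [[a1 _ _ _] _] := diagP x0; have [[b1 _ _ _] _] := diagP y0; rewrite -a1 -b1 e.
Qed.

Lemma card_sub_group_le B (H : {group gT}) : B \subset SL -> (B^-1)%g = B -> H \subset SL ->
  (#|B| * #|H| <= #|(B ^+ 2 :&: H)%g| * q ^ 3)%N.
Proof.
move=> BSL BV HSL; apply: leq_trans (leq_card_cosets BSL HSL) _.
by rewrite BV expgS expg1 leq_mul // card_SL_le.
Qed.

(** Conjugation by [diag y] multiplies the parameter of [unip] by [y ^+ 2], so a representation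
    [z = y^2 x1 + x2 + x3] gives a word of five elements of [B ^+ 2]. Cosets give
    [#|X| >= #|B| / q^2] and [#|Q| >= #|B| / (4 q^2)], whence the threshold [4 q^11]. *)
Lemma large_unipotents B : B \subset SL -> (B^-1)%g = B -> (4 * q ^ 11 < #|B| ^ 4)%N ->
  forall z, unip z \in (B ^+ 10)%g.
Proof.
move=> BSL BV large z.
have q0 : (0 < q)%N by apply: ltnW; exact: card_finNzRing_gt1.
pose X := [set x | unip x \in (B ^+ 2)%g].
pose Y := [set y | (y != 0) && (diag y \in (B ^+ 2)%g)].
pose Q := [set y ^+ 2 | y in Y].
have cardX : (#|B| <= #|X| * q ^ 2)%N.
  have := card_sub_group_le BSL BV unipotents_SL; rewrite card_unipotents /=.
  have le : (#|(B ^+ 2 :&: unipotents)%g| <= #|X|)%N.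
    apply: leq_trans (leq_imset_card unip X); apply/subset_leq_card/subsetP => g /setIP[+ /imsetP[x _ gE]].
    by rewrite gE => xB; apply/imsetP; exists x; rewrite ?inE.
  rewrite expnSr mulnA leq_pmul2r // => /leq_trans-> //.
  by rewrite leq_mul.
have cardY : (#|B| <= 2 * #|Y| * q ^ 2)%N.
  have := card_sub_group_le BSL BV torus_SL; rewrite card_torus /=.
  have le : (#|(B ^+ 2 :&: torus)%g| <= #|Y|)%N.
    apply: leq_trans (leq_imset_card diag Y); apply/subset_leq_card/subsetP => g /setIP[+ /imsetP[x + gE]].
    by rewrite gE in_setC1 => xB x0; apply/imsetP; exists x; rewrite ?inE ?x0.
  move=> le1; have {le} le2 := leq_trans le1 (leq_mul le (leqnn _)).
  have q2 : (q <= 2 * q.-1)%N.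
    rewrite -[X in (X <= _)%N](prednK q0) mul2n -addnn -addn1 leq_add2l -ltnS prednK //.
    exact: card_finNzRing_gt1.
  rewrite -(leq_pmul2r q0); apply: (@leq_trans (#|B| * (2 * q.-1))%N); first by rewrite leq_mul.
  by rewrite mulnCA -!mulnA leq_mul // -expnSr.
have cardQ : (#|Y| <= 2 * #|Q|)%N.
  apply: (card_fibres (f := fun y => y ^+ 2)) => [y yY|c _]; first exact: imset_f.
  set D := [set y in Y | _].
  have [->|[y0]] := set_0Vmem D; first by rewrite cards0.
  rewrite inE => /andP[_ /eqP e0].
  apply: (@leq_trans #|[set y0; - y0]|); last by rewrite cards2; case: (_ == _).
  apply/subset_leq_card/subsetP => y; rewrite !inE => /andP[_ /eqP e].
  by rewrite -eqf_sqr e e0.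
have big : (q ^ 3 < #|X| ^ 3 * #|Q|)%N.
  have le : (#|B| ^ 4 <= (#|X| * q ^ 2) ^ 3 * (4 * #|Q| * q ^ 2))%N.
    rewrite expnSr leq_mul ?leq_exp2r //; apply: leq_trans cardY _.
    by rewrite leq_mul // -[4%N]/(2 * 2)%N -mulnA leq_mul.
  have := leq_trans large le.
  have -> : ((#|X| * q ^ 2) ^ 3 * (4 * #|Q| * q ^ 2) = 4 * q ^ 8 * (#|X| ^ 3 * #|Q|))%N by ring.
  have -> : (4 * q ^ 11 = 4 * q ^ 8 * q ^ 3)%N by ring.
  by rewrite ltn_pmul2l // muln_gt0 expn_gt0 q0.
have [s [x1 [x2 [x3 [[sQ x1X x2X x3X] ->]]]]] := sum_product_covers z big.
case/imsetP: sQ => y; rewrite inE => /andP[y0 yB] ->.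
have -> : unip (y ^+ 2 * x1 + x2 + x3) = (diag y * unip x1 * (diag y)^-1 * unip x2 * unip x3)%g.
  rewrite !unipD; congr (_ * _ * _)%g.
  have [[a1 a2 a3 a4] aSL] := diagP y0; have [[b1 b2 b3 b4] _] := unipP x1.
  have [[c1 c2 c3 c4] _] := unipP (y ^+ 2 * x1).
  apply: ent_inj; rewrite !entM !entV // a1 a2 a3 a4 b1 b2 b3 b4 c1 c2 c3 c4.
  by split; [field | field | ring | field].
rewrite !inE in x1X x2X x3X.
have yVB : (diag y)^-1%g \in (B ^+ 2)%g by rewrite -(invsg_exp _ BV) mem_invg invgK.
exact: mem_expgD (mem_expgD (mem_expgD (mem_expgD yB x1X) yVB) x2X) x3X.
Qed.

(** If [e10 g] is nonzero, [g] is upper times lower times upper unipotent, in [B ^+ 30]. If it is 0,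
    multiplying by [lunip 1] makes it nonzero, at the cost of one more unipotent. *)
Lemma large_set_generates B : B \subset SL -> (B^-1)%g = B -> (4 * q ^ 11 < #|B| ^ 4)%N ->
  SL \subset (B ^+ 40)%g.
Proof.
move=> BSL BV large.
have uB := large_unipotents BSL BV large.
(* This Weyl element exchanges upper and lower unipotents, so the previous lemma for [B :^ w]
   supplies the lower ones. *)
have [|[w1 w2 w3 w4] wSL] := @mk_SL _ gT 0 1 (-1) 0; first ring.
set w := mk _ _ _ _ _ in w1 w2 w3 w4 wSL.
have lB x : lunip x \in (B ^+ 10)%g.
  have : unip (- x) \in ((B :^ w) ^+ 10)%g.
    apply: large_unipotents; last by rewrite cardJg.
      by apply/subsetP => _ /imsetP[g /(subsetP BSL) gSL ->]; rewrite groupJ.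
    by rewrite -conjsVg BV.
  rewrite -conjsXg mem_conjg.
  have [[a1 a2 a3 a4] _] := unipP (- x); have [[b1 b2 b3 b4] _] := lunipP x.
  suff -> : (unip (- x) ^ w^-1)%g = lunip x by [].
  rewrite conjgE invgK; apply: ent_inj; rewrite !entM !entV // a1 a2 a3 a4 b1 b2 b3 b4 w1 w2 w3 w4.
  by split; ring.
have three g : g \in SL -> e10 g != 0 -> g \in (B ^+ 30)%g.
  move=> gSL c0.
  have -> : g = (unip ((e00 g - 1) / e10 g)%R * lunip (e10 g) * unip ((e11 g - 1) / e10 g)%R)%g.
    set x := (_ - 1) / _; set y := (_ - 1) / _.
    have [[a1 a2 a3 a4] _] := unipP x; have [[b1 b2 b3 b4] _] := unipP y.
    have [[c1 c2 c3 c4] _] := lunipP (e10 g).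
    apply: ent_inj; rewrite !entM a1 a2 a3 a4 b1 b2 b3 b4 c1 c2 c3 c4 /x /y.
    have dg := SL_det gSL.
    split; [by field | | by ring | by field].
    apply: (eq_divr c0); apply: (eq_combr (k := -1) dg); field => //.
  exact: mem_expgD (mem_expgD (uB _) (lB _)) (uB _).
apply/subsetP => g gSL.
have B1 : 1%g \in (B ^+ 10)%g by rewrite -unip0.
have [c0|c0] := eqVneq (e10 g) 0; last first.
  by rewrite -(mulg1 g) (_ : 40 = 30 + 10)%N //; apply: mem_expgD; first exact: three.
have [[a1 a2 a3 a4] lSL] := lunipP 1; have [[b1 b2 b3 b4] _] := lunipP (-1).
have -> : g = ((g * lunip 1%R) * lunip (-1)%R)%g.
  by apply: ent_inj; rewrite !entM a1 a2 a3 a4 b1 b2 b3 b4; split; ring.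
rewrite (_ : 40 = 30 + 10)%N //; apply: mem_expgD => //; apply: three; first by rewrite groupM.
rewrite !entM a1 a3 c0 mul0r mulr1 add0r; apply/negP => /eqP d0.
by move/eqP: (SL_det gSL); rewrite c0 d0 !mulr0 subrr eq_sym oner_eq0.
Qed.
End LargeSets.

Import Order.TTheory Num.Theory.

(** * The group SL_2(Z/pZ) *)

Section GL2Model.
Variable p : nat.
Local Notation F := 'F_p.
Implicit Types (g h : {'GL_2(p)}).

Lemma ord2P (P : 'I_2 -> Prop) : P 0 -> P 1 -> forall i, P i.
Proof.
move=> P0 P1 [[|[|//]] lt_i2].
  by have -> : Ordinal lt_i2 = 0 by apply: val_inj.
by have -> : Ordinal lt_i2 = 1 by apply: val_inj.
Qed.

Lemma sum2 (f : 'I_2 -> F) : \sum_i f i = f 0 + f 1.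
Proof. by rewrite big_ord_recl big_ord1; congr (_ + f _); apply: val_inj. Qed.

Lemma det2 (M : 'M[F]_2) : \det M = M 0 0 * M 1 1 - M 0 1 * M 1 0.
Proof.
rewrite (expand_det_row M 0) sum2 /cofactor !det_mx11 !mxE /=.
rewrite addn0 addn1 expr0 expr1 mulN1r mul1r mulrN.
by congr (_ * M _ _ - _ * M _ _); apply: val_inj.
Qed.

(** The default [1] is returned only for a singular matrix. *)
Definition gl_mk (a b c d : F) : {'GL_2(p)} :=
  insubd (1%g : {'GL_2(p)}) (\matrix_(i, j) if i == 0 then (if j == 0 then a else b)
                           else (if j == 0 then c else d)).

Lemma gl_ent_inj g h : [/\ GLval g 0 0 = GLval h 0 0, GLval g 0 1 = GLval h 0 1,
  GLval g 1 0 = GLval h 1 0 & GLval g 1 1 = GLval h 1 1] -> g = h.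
Proof.
case=> h0 h1 h2 h3; apply/val_inj/matrixP=> i j.
by move: i j; apply: ord2P; apply: ord2P.
Qed.

Lemma gl_entM g h :
  (GLval (g * h)%g 0 0 = GLval g 0 0 * GLval h 0 0 + GLval g 0 1 * GLval h 1 0) *
  (GLval (g * h)%g 0 1 = GLval g 0 0 * GLval h 0 1 + GLval g 0 1 * GLval h 1 1) *
  (GLval (g * h)%g 1 0 = GLval g 1 0 * GLval h 0 0 + GLval g 1 1 * GLval h 1 0) *
  (GLval (g * h)%g 1 1 = GLval g 1 0 * GLval h 0 1 + GLval g 1 1 * GLval h 1 1).
Proof. by rewrite GL_MxE !mxE !sum2. Qed.

Lemma gl_ent1 : (GLval (1 : {'GL_2(p)})%g 0 0 = 1) * (GLval (1 : {'GL_2(p)})%g 0 1 = 0) *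
  (GLval (1 : {'GL_2(p)})%g 1 0 = 0) * (GLval (1 : {'GL_2(p)})%g 1 1 = 1).
Proof. by rewrite GL_1E !mxE. Qed.

Lemma gl_mem_SL2 g :
  (g \in SL2 p) = (GLval g 0 0 * GLval g 1 1 - GLval g 0 1 * GLval g 1 0 == 1).
Proof. by rewrite inE det2. Qed.

Lemma gl_mkP (a b c d : F) : a * d - b * c = 1 ->
  [/\ GLval (gl_mk a b c d) 0 0 = a, GLval (gl_mk a b c d) 0 1 = b,
      GLval (gl_mk a b c d) 1 0 = c & GLval (gl_mk a b c d) 1 1 = d].
Proof.
move=> abcd; rewrite /gl_mk; set M := \matrix_(i, j) _.
have uM : M \in unitmx by rewrite unitmxE det2 !mxE /= abcd unitr1.
by rewrite val_insubd uM !mxE.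
Qed.

Definition gl_model : matrix_model F :=
  @MatrixModel F {'GL_2(p)} (SL2_group p) (fun g => GLval g 0 0) (fun g => GLval g 0 1)
    (fun g => GLval g 1 0) (fun g => GLval g 1 1) gl_mk gl_ent_inj gl_entM gl_ent1
    gl_mem_SL2 gl_mkP.
End GL2Model.

Definition generating (p : nat) (A : {set {'GL_2(p)}}) :=
  A \subset SL2 p /\ (forall H : {group {'GL_2(p)}}, H \proper SL2 p -> ~~ (A \subset H)).

Section Prime.
Variables (p : nat) (p_prime : prime p).
Implicit Types A B : {set {'GL_2(p)}}.

Lemma generating_neq0 A : generating A -> A != set0.
Proof.
case=> _ gen; apply: contra (gen (borel_group (gl_model p) None) (borel_proper (gl_model p) None)).
by move=> /eqP->; apply: sub0set.
Qed.

Lemma card_SL2_le : (#|SL2 p| <= p ^ 3)%N.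
Proof. by have := card_SL_le (gl_model p); rewrite card_Fp. Qed.

Lemma Fp_natr_neq0 n : (0 < n < p)%N -> n%:R != 0 :> 'F_p.
Proof. by move=> /andP[n0 np]; rewrite -(dvdn_pcharf (pchar_Fp p_prime)) gtnNdvd. Qed.

Lemma SL2_growth_alternative A : (3 < p)%N -> generating A -> (A^-1)%g = A -> 1%g \in A ->
  (#|A| ^ 3 <= 13 * 64 * #|(A ^+ 36)%g| ^ 2)%N \/
  (p ^ 6 * #|A| ^ 3 <= 16 ^ 3 * 13 * #|(A ^+ 36)%g| ^ 5)%N.
Proof.
move=> p3 [ASL gen] AV A1.
have two : 1 + 1 != 0 :> 'F_p by exact: (@Fp_natr_neq0 2 (ltnW p3)).
have three : 1 + 1 + 1 != 0 :> 'F_p by rewrite -addrA; apply: (@Fp_natr_neq0 3).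
by have := growth_alternative (gT := gl_model p) two three ASL gen AV A1; rewrite card_Fp.
Qed.

Lemma SL2_large_set B : B \subset SL2 p -> (B^-1)%g = B -> (4 * p ^ 11 < #|B| ^ 4)%N ->
  SL2 p \subset (B ^+ 40)%g.
Proof.
move=> BSL BV le.
by apply: (large_set_generates (gT := gl_model p) BSL BV); rewrite card_Fp.
Qed.
End Prime.

(** * Growth *)

Section Combine.
Local Open Scope nat_scope.
(** For the symmetrisation [S] of [A]: [n = #|A|], [s = #|S|], [S3 = #|S ^+ 3|], [N = #|S ^+ 36|],
    [T = #|A * A * A|] and [k = 27]. *)
Variables (k n s S3 N T : nat).
Hypothesis n_le_s : n <= s.
Hypothesis small : N * s ^ 33 <= S3 ^ 34.
Hypothesis tripling : S3 * n ^ 2 <= k * T ^ 3.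

Lemma power_bound : N * n ^ 101 <= k ^ 34 * T ^ 102.
Proof.
rewrite -[102]/(3 * 34)%N expnM -expnMn.
apply: leq_trans (_ : (S3 * n ^ 2) ^ 34 <= _); last by rewrite leq_exp2r.
rewrite expnMn -expnM -[101]/(33 + 68)%N expnD mulnA leq_mul //.
by apply: leq_trans small; rewrite leq_mul // leq_exp2r.
Qed.

(** Growth comes from [205 = 3 + 2 * 101] exceeding [204 = 2 * 102]. *)
Lemma power_bound2 c : s ^ 3 <= c * N ^ 2 -> n ^ 205 <= c * (k ^ 34) ^ 2 * T ^ 204.
Proof.
move=> le; rewrite -[204]/(102 * 2)%N [T ^ _]expnM -mulnA -expnMn.
apply: leq_trans (_ : c * (N * n ^ 101) ^ 2 <= _); last by rewrite leq_mul // leq_exp2r // power_bound.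
rewrite expnMn mulnA -expnM -[205]/(3 + 101 * 2)%N expnD leq_mul //.
by apply: leq_trans le; rewrite leq_exp2r.
Qed.

(** Now [508 = 3 + 5 * 101] falls short of [510 = 5 * 102]; with [r = p ^ 6] the deficit [n ^ 2] is
    recovered when [n] stays below [p ^ 3] by a power of [p]. *)
Lemma power_bound5 c r : r * s ^ 3 <= c * N ^ 5 -> r * n ^ 508 <= c * (k ^ 34) ^ 5 * T ^ 510.
Proof.
move=> le; rewrite -[510]/(102 * 5)%N [T ^ _]expnM -mulnA -expnMn.
apply: leq_trans (_ : c * (N * n ^ 101) ^ 5 <= _); last by rewrite leq_mul // leq_exp2r // power_bound.
rewrite expnMn mulnA -expnM -[508]/(3 + 101 * 5)%N expnD mulnA leq_mul //.
by apply: leq_trans le; rewrite leq_mul // leq_exp2r.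
Qed.
End Combine.

Lemma symmetrization_generating (p : nat) (A : {set {'GL_2(p)}}) : generating A ->
  generating (1%g |: (A :|: A^-1)%g).
Proof.
case=> ASL gen; split=> [|H /gen]; last first.
  by apply: contra => sub; apply: subset_trans sub; rewrite setUA setUAC subsetUr.
by rewrite !subUset sub1set group1 ASL /= -(invGid (SL2_group p)) invSg.
Qed.

Lemma symmetrizationV (gT : finGroupType) (A : {set gT}) :
  ((1 |: (A :|: A^-1))^-1 = 1 |: (A :|: A^-1))%g.
Proof. by rewrite !invUg invg1 invgK [(_^-1 :|: A)%g]setUC. Qed.

Lemma SL2_growth_counts : exists2 C : nat, (0 < C)%N &
  forall (p : nat) (A : {set {'GL_2(p)}}), prime p -> (3 < p)%N -> generating A ->
  (#|A| ^ 205 <= C * #|(A * A * A)%g| ^ 204)%N \/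
  (p ^ 6 * #|A| ^ 508 <= C * #|(A * A * A)%g| ^ 510)%N.
Proof.
(* The constants are hidden behind equations so that powers such as [27 ^ 34] stay symbolic. *)
have [k kE] : exists k, k = 27%N by exists 27%N.
have [c1 c1E] : exists c, c = (13 * 64)%N by exists (13 * 64)%N.
have [c2 c2E] : exists c, c = (16 ^ 3 * 13)%N by exists (16 ^ 3 * 13)%N.
exists (c1 * (k ^ 34) ^ 2 + c2 * (k ^ 34) ^ 5).+1 => //.
move=> p A p_prime p3 gen; set S := (1 |: (A :|: A^-1))%g.
have n_le_s : (#|A| <= #|S|)%N by rewrite subset_leq_card // /S setUA setUAC subsetUr.
have small : (#|(S ^+ 36)%g| * #|S| ^ 33 <= #|(S ^+ 3)%g| ^ 34)%N.
  exact: (small_tripling 33 (symmetrizationV A)).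
have trip := symmetrized_tripling A; rewrite -/S -kE in trip.
have S1 : (1%g \in S) by rewrite setU11.
have [le|le] := SL2_growth_alternative p_prime p3 (symmetrization_generating gen) (symmetrizationV A) S1; [left|right].
  rewrite -c1E in le; apply: leq_trans (power_bound2 n_le_s small trip le) _.
  by rewrite leq_mul // leqW ?leq_addr.
rewrite -c2E in le; apply: leq_trans (power_bound5 n_le_s small trip le) _.
by rewrite leq_mul // leqW ?leq_addl.
Qed.

(** * From integer counts to real exponents *)

Section RealExponents.
Variable R : realType.

(** If [T <= c a], then [T ^+ k <= c ^+ k * a ^+ k <= c * C * T ^+ k < T ^+ k], using [c <= 1]. *)
Lemma lt_of_power_bound (a c C T : R) k : (0 < k)%N -> 0 < T -> 0 <= a -> 0 < c -> c <= 1 ->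
  c * C < 1 -> a ^+ k <= C * T ^+ k -> c * a < T.
Proof.
move=> k0 T0 a0 c0 c1 cC le; rewrite ltNge; apply/negP => Tle.
have : T ^+ k <= c * C * T ^+ k.
  apply: le_trans (_ : (c * a) ^+ k <= _); first by apply: lerXn2r => //; rewrite nnegrE ?mulr_ge0 // ltW.
  rewrite exprMn -mulrA; apply: le_trans (_ : c * a ^+ k <= _); last by rewrite ler_pM2l.
  apply: ler_wpM2r; first exact: exprn_ge0.
  by case: k k0 {le} => // k _; rewrite exprS; apply: ler_piMr; [exact: ltW | apply: exprn_ile1 => //; exact: ltW].
have Tk : 0 < T ^+ k by exact: exprn_gt0.
by rewrite leNgt gtr_pMl ?cC.
Qed.

Lemma SL2_growth (delta : R) : 0 < delta -> exists c eps : R, [/\ 0 < c, 0 < eps &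
  forall (p : nat) (A : {set {'GL_2(p)}}), prime p -> generating A ->
    #|A|%:R < p%:R `^ (3 - delta) ->
    c * #|A|%:R `^ (1 + eps) < #|(A * A * A)%g|%:R].
Proof.
move=> delta0; have [C C0 counts] := SL2_growth_counts.
(* The two alternatives of the counts need 204 eps <= 1 and 510 eps <= x / 2. *)
pose x := Num.min delta 1; pose eps := x / 1020; pose c := (54 * C%:R)^-1 : R.
have [x0 x1 xd] : [/\ 0 < x, x <= 1 & x <= delta].
  by rewrite /x lt_min delta0 ltr01 !ge_min !lexx orbT.
have C1 : 1 <= C%:R :> R by rewrite ler1n.
have eps0 : 0 < eps by rewrite divr_gt0.
have c0 : 0 < c by rewrite invr_gt0; lra.
have c1 : c <= 1 by rewrite invf_le1; lra.
have cC : c * (27 * C%:R) < 1 by rewrite /c mulrC ltr_pdivrMr; lra.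
exists c, eps; split=> // p A p_prime gen lt.
set n := #|A|; set T := #|(A * A * A)%g|.
have A0 := generating_neq0 gen.
have n0 : (0 < n)%N by rewrite card_gt0.
have nT : (n <= T)%N.
  by apply: leq_trans (leq_card_mulsr (A * A)%g A0); apply: leq_card_mulsr.
have n1R : 1 <= n%:R :> R by rewrite ler1n.
have n0R : 0 <= n%:R :> R by exact: ler0n.
have T0 : 0 < T%:R :> R by rewrite ltr0n (leq_trans n0).
have a0 : 0 <= n%:R `^ (1 + eps) :> R by exact: powR_ge0.
have p1 : 1 <= p%:R :> R by rewrite ler1n prime_gt0.
have CT k : C%:R * T%:R ^+ k <= 27 * C%:R * T%:R ^+ k :> R.
  by rewrite ler_pM2r ?exprn_gt0 //; lra.
(* For [p <= 3] the whole group has at most 27 elements, so [n^(1 + eps) <= n^2 <= 27 n]; this is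
   why 27 enters [c]. *)
have [p3|p3] := leqP p 3.
  apply: (@lt_of_power_bound _ _ (27 * C%:R) _ 1) => //; rewrite !expr1.
  have n27 : (n <= 27)%N.
    apply: leq_trans (subset_leq_card gen.1) _; apply: leq_trans (card_SL2_le p_prime) _.
    by rewrite -[27%N]/(3 ^ 3)%N leq_exp2r.
  apply: le_trans (_ : n%:R `^ 2%:R <= _); first by apply: ler_powR => //; rewrite /eps; lra.
  rewrite powR_mulrn // expr2; apply: ler_pM => //; last by rewrite ler_nat.
  apply: le_trans (_ : 27 <= _); first by rewrite (ler_nat _ _ 27).
  lra.
have [le|le] := counts p A p_prime p3 gen.
  apply: (@lt_of_power_bound _ _ (27 * C%:R) _ 204) => //.
  apply: le_trans (CT _); rewrite -powR_mulrn // -powRrM.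
  apply: le_trans (_ : n%:R `^ 205%:R <= _).
    by apply: ler_powR => //; rewrite /eps; lra.
  by rewrite powR_mulrn // -!natrX -natrM ler_nat.
apply: (@lt_of_power_bound _ _ (27 * C%:R) _ 510) => //.
apply: le_trans (CT _); rewrite -powR_mulrn // -powRrM.
(* The surplus [n^(2 + x / 2)] is at most [p ^ 6], because [n <= p^(3 - x)] and
   [(3 - x) (2 + x / 2) <= 6]. *)
have -> : (1 + eps) * 510 = 508%:R + (2 + x / 2) by rewrite /eps; field.
rewrite powRD; last by apply/implyP => _; rewrite pnatr_eq0 -lt0n.
apply: le_trans (_ : n%:R ^+ 508 * p%:R ^+ 6 <= _); last first.
  by rewrite -!natrX -!natrM ler_nat mulnC.
rewrite powR_mulrn // ler_wpM2l ?exprn_ge0 //.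
have le1 : n%:R <= p%:R `^ (3 - x) :> R.
  by apply: le_trans (ltW lt) _; apply: ler_powR => //; lra.
apply: le_trans (_ : (p%:R `^ (3 - x)) `^ (2 + x / 2) <= _).
  by apply: ge0_ler_powR; rewrite ?nnegrE ?powR_ge0 //; lra.
rewrite -powRrM -powR_mulrn //; apply: ler_powR => //.
by nra.
Qed.
End RealExponents.

(** * Generation *)

Lemma mem_exps_prod (gT : finGroupType) (B : {set gT}) n g : g \in ((1 |: B) ^+ n)%g ->
  exists s : seq gT, [/\ (size s <= n)%N, {subset s <= B} & g = (\prod_(x <- s) x)%g].
Proof.
elim: n g => [|n IH] g.
  by rewrite expg0 => /set1P ->; exists [::]; rewrite big_nil.
rewrite expgS => /mulsgP[b h /setU1P bB /IH[s [sn sB ->]] ->].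
case: bB => [->|bB]; first by exists s; rewrite mul1g; split=> //; apply: leqW.
exists (b :: s); rewrite big_cons; split=> // x; rewrite in_cons => /orP[/eqP->|/sB] //.
Qed.

(** Only finitely many pairs [(p, A)] occur, so the maximum of the exponents provided by [gen_expgs]
    serves for all. *)
Lemma SL2_small_primes m : exists k : nat, forall (p : nat) (A : {set {'GL_2(p)}}),
  (p < m)%N -> generating A -> SL2 p \subset ((1 |: (A :|: A^-1)) ^+ k)%g.
Proof.
exists (\max_(p < m) \max_(A : {set {'GL_2(p)}}) sval (gen_expgs A))%N => p A pm [ASL gen].
have -> : SL2 p = <<A>>%g.
  apply/eqP; rewrite eq_sym eqEproper gen_subG ASL /=; apply/negP => lt.
  by case/negP: (gen <<A>>%G lt); apply: subset_gen.
rewrite (svalP (gen_expgs A)).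
apply: subset_trans (expsgS _ _) (expsg_subl _ _).
- by rewrite setUA subsetUl.
- by rewrite setU11.
pose f (q : nat) := (\max_(B : {set {'GL_2(q)}}) sval (gen_expgs B))%N.
apply: leq_trans (leq_bigmax (F := fun q : 'I_m => f q) (Ordinal pm)).
exact: (leq_bigmax (F := fun B : {set {'GL_2(p)}} => sval (gen_expgs B)) A).
Qed.

Section Generation.
Variable R : realType.

Lemma powR_large (a M : R) : 0 < a -> exists m : nat, forall p : nat, (m <= p)%N -> M <= p%:R `^ a.
Proof.
move=> a0; have [M0|M0] := leP M 0; first by exists 0 => p _; apply: le_trans M0 (powR_ge0 _ _).
exists (Num.bound (M `^ a^-1)) => p mp.
have le : M `^ a^-1 <= p%:R.
  by apply: le_trans (ltW (archi_boundP (powR_ge0 _ _))) _; rewrite ler_nat.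
have <- : (M `^ a^-1) `^ a = M.
  by rewrite -powRrM mulVf ?gt_eqF // powRr1 // ltW.
by apply: ge0_ler_powR => //; rewrite ?nnegrE ?powR_ge0 // ltW.
Qed.

Lemma SL2_generation (delta : R) : 0 < delta -> exists2 k : nat, (0 < k)%N &
  forall (p : nat) (A : {set {'GL_2(p)}}), prime p -> generating A ->
    p%:R `^ delta < #|A|%:R -> SL2 p \subset ((1 |: (A :|: A^-1)) ^+ k)%g.
Proof.
move=> delta0.
have [|c [eps [c0 eps0 growth]]] := @SL2_growth R (1 / 8); first by lra.
(* One step multiplies the size by at least [c p^(delta eps) = c p^a p^a]; for large [p] one factor
   [p^a] absorbs [c] and the other is the net gain. *)
pose a := delta * eps / 2; have a0 : 0 < a by rewrite divr_gt0 ?mulr_gt0.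
have [m1 large1] := powR_large c^-1 a0.
(* [p^(1/2) >= 5] beats the factor 4 in the threshold [4 p^11], since [4 (3 - 1/8) = 11 + 1/2]. *)
have [|m2 large2] := @powR_large (1 / 2) 5; first by lra.
pose m := maxn m1 (maxn m2 4).
have [k1 small] := SL2_small_primes m.
pose J := Num.bound (3 / a).
have Ja : 3 <= J%:R * a.
  by rewrite -ler_pdivrMr //; apply: ltW; apply: archi_boundP; rewrite divr_ge0 // ltW.
exists (maxn k1 (3 ^ J * 40)).+1 => // p A p_prime gen lt.
set S := (1 |: (A :|: A^-1))%g.
have S1 : 1%g \in S by exact: setU11.
have SV : (S^-1 = S)%g by exact: symmetrizationV.
have genS : generating S by exact: symmetrization_generating.
have [pm|mp] := ltnP p m.
  by apply: subset_trans (small p A pm gen) (expsg_subl S1 _); rewrite leqW ?leq_maxl.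
have p1 : 1 <= p%:R :> R by rewrite ler1n prime_gt0.
have p0 : 0 < p%:R :> R by lra.
have cp : 1 <= c * p%:R `^ a.
  rewrite -ler_pdivrMl // mulr1; apply: large1; apply: leq_trans mp; exact: leq_maxl.
have p5 : 5 <= p%:R `^ (1 / 2) :> R.
  by apply: large2; apply: leq_trans mp; rewrite /m leq_max leq_maxl orbT.
pose B j := (S ^+ (3 ^ j))%g.
have BS j : (B j.+1 = B j * B j * B j)%g by rewrite /B expnSr expgM -[3%N]/(1 + 1 + 1)%N !expgD expg1.
have SB j : S \subset B j.
  by have := @expsg_subl _ S 1 (3 ^ j) S1; rewrite expg1; apply; rewrite expn_gt0.
have genB j : generating (B j).
  elim: j => [|j [IH1 IH2]]; first by rewrite /B expn0 expg1.
  split; last first.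
    by move=> H /(genS.2 H); apply: contra; apply: subset_trans.
  apply/subsetP => x; rewrite BS => /mulsgP[y z /mulsgP[u v uB vB ->] zB ->].
  by rewrite !(groupM (G := SL2_group p)) // (subsetP IH1).
have Bmono j : (#|B j| <= #|B j.+1|)%N.
  by apply/subset_leq_card/expsg_subl; rewrite ?leq_exp2l.
(* Either the target size is already reached, or every step so far has gained a factor [p^a]. *)
have grow j : p%:R `^ (3 - 1 / 8) <= #|B j|%:R :> R \/ p%:R `^ (j%:R * a) <= #|B j|%:R :> R.
  elim: j => [|j IH].
    by right; rewrite mul0r powRr0 ler1n card_gt0; apply/set0Pn; exists 1%g; rewrite /B expn0 expg1.
  have [big|small'] := leP (p%:R `^ (3 - 1 / 8)) (#|B j|%:R : R).
    by left; apply: le_trans big _; rewrite ler_nat.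
  right; case: IH => [|IH]; first by rewrite leNgt small'.
  have := growth p (B j) p_prime (genB j) small'; rewrite -BS => /ltW; apply: le_trans.
  set b := #|B j|.
  have b0 : (0 < b)%N by rewrite card_gt0 generating_neq0.
  have bd : p%:R `^ delta <= b%:R :> R.
    apply: le_trans (ltW lt) _; rewrite ler_nat subset_leq_card //.
    by apply: subset_trans (SB j); rewrite /S setUA setUAC subsetUr.
  rewrite powRD; last by apply/implyP => _; rewrite pnatr_eq0 -lt0n.
  rewrite powRr1 ?ler0n // -natr1 mulrDl mul1r powRD; last by apply/implyP => _; rewrite gt_eqF.
  rewrite [X in _ <= X]mulrCA; apply: ler_pM; rewrite ?powR_ge0 //.
  have be : p%:R `^ a * p%:R `^ a <= b%:R `^ eps :> R.
    rewrite -powRD; last by apply/implyP => _; rewrite gt_eqF.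
    have -> : a + a = delta * eps by rewrite /a; field.
    by rewrite powRrM; apply: ge0_ler_powR; rewrite ?nnegrE ?powR_ge0 ?ler0n // ltW.
  apply: le_trans (_ : c * (p%:R `^ a * p%:R `^ a) <= _); last by rewrite ler_pM2l.
  by rewrite mulrA ler_peMl ?powR_ge0.
have bigJ : p%:R `^ (3 - 1 / 8) <= #|B J|%:R :> R.
  case: (grow J) => // le; apply: le_trans le; apply: ler_powR => //; lra.
have big4 : (4 * p ^ 11 < #|B J| ^ 4)%N.
  rewrite -(ltr_nat R) natrM !natrX.
  apply: lt_le_trans (_ : (p%:R `^ (3 - 1 / 8)) ^+ 4 <= _); last first.
    by apply: lerXn2r; rewrite ?nnegrE ?powR_ge0 ?ler0n.
  rewrite -powR_mulrn ?powR_ge0 // -powRrM.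
  have -> : (3 - 1 / 8) * 4 = 1 / 2 + 11%:R :> R by field.
  rewrite powRD; last by apply/implyP => _; rewrite gt_eqF.
  rewrite powR_mulrn ?ler0n // ltr_pM2r ?exprn_gt0 //; lra.
have BV : ((B J)^-1 = B J)%g by exact: invsg_exp.
have := SL2_large_set p_prime (genB J).1 BV big4.
move/subset_trans; apply; rewrite /B -expgM; apply: expsg_subl => //.
by rewrite leqW ?leq_maxr.
Qed.
End Generation.

Theorem mainTheorem2 (R : realType) :
  (forall delta : R, 0 < delta ->
     exists c eps : R, [/\ 0 < c, 0 < eps &
       forall (p : nat) (A : {set {'GL_2(p)}}),
         prime p ->
         A \subset SL2 p ->
         (forall H : {group {'GL_2(p)}}, H \proper SL2 p -> ~~ (A \subset H)) ->
         #|A|%:R < p%:R `^ (3 - delta) ->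
         c * #|A|%:R `^ (1 + eps) < #|(A * A * A)%g|%:R])
  /\
  (forall delta : R, 0 < delta ->
     exists2 k : nat, (0 < k)%N &
       forall (p : nat) (A : {set {'GL_2(p)}}),
         prime p ->
         A \subset SL2 p ->
         (forall H : {group {'GL_2(p)}}, H \proper SL2 p -> ~~ (A \subset H)) ->
         p%:R `^ delta < #|A|%:R ->
         forall g : {'GL_2(p)}, g \in SL2 p ->
           exists s : seq {'GL_2(p)},
             [/\ (size s <= k)%N,
                 {subset s <= (A :|: A^-1)%g} &
                 g = (\prod_(x <- s) x)%g]).
Proof.
split=> delta delta0.
  have [c [eps [c0 eps0 growth]]] := SL2_growth delta0.
  by exists c, eps; split=> // p A p_prime ASL gen; apply: growth.
have [k k0 cover] := SL2_generation delta0.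
exists k => // p A p_prime ASL gen lt g gSL.
have gk := subsetP (cover p A p_prime (conj ASL gen) lt) g gSL.
by have [s [sk sA gE]] := mem_exps_prod gk; exists s.
Qed.
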